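(* For all non-negative integers $y,t,a,x$, the number $\operatorname{CSTC}(\mathcal{H}_{2t,y}(2a,2x))$ of lozenge tilings of $\mathcal{H}_{2t,y}(2a,2x)$ that are invariant under rotation by $120^\circ$ about the center and under reflection across the vertical symmetry axis equals $P_1(x+1,y,t-y-1,a)$.
   Context: Triangular lattice with horizontal lattice lines; hexagon side lengths listed clockwise from the northwestern side. For non-negative integers $x,y,a,t$, $\mathcal{H}_{t,y}(a,x)$ is obtained from the hexagon with side lengths $t+x+3a,\ t,\ t+x+3a,\ t,\ t+x+3a,\ t$ by removing an up-pointing triangle of side $x$ from the center and three up-pointing triangles of side $a$ placed along the segments from the center to the midpoints of the southern, northeastern and northwestern sides, with distance $2y$ from the central hole to each satellite hole. Pochhammer: $(x)_n=x(x+1)\cdots(x+n-1)$ ($n>0$), $(x)_0=1$, $(x)_{-n}=1/((x-1)\cdots(x-n))$. Skipped Pochhammer: $[x]_n=x(x+2)\cdots(x+2n-2)$ ($n>0$), $[x]_0=1$, $[x]_n=1/((x-2)(x-4)\cdots(x+2n))$ ($n<0$). \begin{align*} P_1(x,y,z,a)&=\frac{1}{2^{y+z}}\prod_{i=1}^{y+z}\frac{(2x+6a+2i)_i[2x+6a+4i+1]_{i-1}}{(i)_i[2x+6a+2i+1]_{i-1}}\\ &\times\prod_{i=1}^{a}\frac{(z+i)_{y+a-2i+1}(x+y+2z+2a+2i)_{2y+2a-4i+2}(x+3i-2)_{y-i+1}(x+3y+2i-1)_{i-1}}{(i)_y(y+2z+2i-1)_{y+2a-4i+3}(2z+2i)_{y+2a-4i+1}(x+y+z+2a+i)_{y+a-2i+1}}.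 \end{align*}
   Formalization: The formal theorem assumes y < t. Otherwise the claim fails: for t=y=a=0 the formula gives 2 but there is 1 tiling; for y=t≥1, a≥1 it has a zero denominator; for y>t, a≥1 the satellites leave the hexagon; for a=0, t≥1 nothing depends on y. *)

(* Defs.v *)
From HB Require Import structures.
From mathcomp Require Import all_boot all_order all_algebra.
From mathcomp Require Import finmap.
Set Implicit Arguments. Unset Strict Implicit. Unset Printing Implicit Defensive.
Import Order.TTheory GRing.Theory Num.Theory.
Local Open Scope ring_scope.

Definition poch (x : rat) (n : int) : rat :=
  match n with
  | Posz m => \prod_(k < m) (x + k%:R)
  | Negz m => (\prod_(k < m.+1) (x - (k.+1)%:R))^-1
  end.

Definition spoch (x : rat) (n : int) : rat :=
  match n with
  | Posz m => \prod_(k < m) (x + (2 * k)%:R)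
  | Negz m => (\prod_(k < m.+1) (x - (2 * k.+1)%:R))^-1
  end.

Definition iprod (n : int) (F : int -> rat) : rat :=
  match n with
  | Posz m => \prod_(1 <= i < m.+1) F i%:Z
  | Negz _ => 1
  end.

Definition P1 (x y z a : int) : rat :=
  ((2%:R : rat) ^ (y + z))^-1 *
  iprod (y + z) (fun i =>
     poch (2 * x + 6 * a + 2 * i)%:~R i * spoch (2 * x + 6 * a + 4 * i + 1)%:~R (i - 1)
     / (poch i%:~R i * spoch (2 * x + 6 * a + 2 * i + 1)%:~R (i - 1))) *
  iprod a (fun i =>
     poch (z + i)%:~R (y + a - 2 * i + 1)
     * poch (x + y + 2 * z + 2 * a + 2 * i)%:~R (2 * y + 2 * a - 4 * i + 2)
     * poch (x + 3 * i - 2)%:~R (y - i + 1)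
     * poch (x + 3 * y + 2 * i - 1)%:~R (i - 1)
     / (poch i%:~R y
        * poch (y + 2 * z + 2 * i - 1)%:~R (y + 2 * a - 4 * i + 3)
        * poch (2 * z + 2 * i)%:~R (y + 2 * a - 4 * i + 1)
        * poch (x + y + z + 2 * a + i)%:~R (y + a - 2 * i + 1))).

(* The triangular lattice (horizontal lattice lines).                       *)
(* Points: (i, j) : int * int, standing for i*e1 + j*e2 with e1 = (1,0),    *)
(* e2 = (1/2, sqrt 3/2).  Unit triangles: (i, j, true) is the up-pointing   *)
(* triangle with vertices (i,j), (i+1,j), (i,j+1); (i, j, false) is the     *)
(* down-pointing triangle with vertices (i+1,j), (i,j+1), (i+1,j+1).        *)

Definition tri := (int * int * bool)%type.

(* the unit triangle tr lies in the up-pointing triangle of side n whose    *)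
(* lower-left vertex is (ox, oy)                                            *)
Definition in_up_triangle (ox oy n : int) (tr : tri) : bool :=
  let: (i, j, up) := tr in
  [&& 0 <= i - ox, 0 <= j - oy &
      if up then (i - ox) + (j - oy) <= n - 1 else (i - ox) + (j - oy) <= n - 2].

(* A lozenge is a pair (u, d) of an up- and a down-pointing unit triangle    *)
(* sharing an edge.  The down triangles sharing an edge with the up triangle *)
(* (i,j) are (i,j), (i-1,j), (i,j-1).                                        *)
Definition loz := (tri * tri)%type.

Definition is_lozenge (l : loz) : bool :=
  let: ((i, j, u), (i', j', d)) := l in
  [&& u, ~~ d & ((i', j') == (i, j)) || ((i', j') == (i - 1, j)) || ((i', j') == (i, j - 1))].

Definition covers (l : loz) (tr : tri) : bool := (l.1 == tr) || (l.2 == tr).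

(* The hexagon with side lengths 2t+2x+6a, 2t, 2t+2x+6a, 2t, 2t+2x+6a, 2t   *)
(* (clockwise from the NW side) is the up-pointing triangle of side         *)
(* L = 6t+2x+6a with lower-left vertex (0,0), minus its three corner        *)
(* up-pointing triangles of side 2t.  Its center is the centroid of that    *)
(* big triangle.                                                            *)

Definition bigL (t a x : nat) : int := (6 * t + 2 * x + 6 * a)%:Z.

Definition in_hexagon (t a x : nat) (tr : tri) : bool :=
  let L := bigL t a x in
  let B := (2 * t)%:Z in
  [&& in_up_triangle 0 0 L tr,
      ~~ in_up_triangle 0 0 B tr,
      ~~ in_up_triangle (L - B) 0 B tr &
      ~~ in_up_triangle 0 (L - B) B tr].

(* rotation by 120 degrees about the center: point (i,j) |-> (L-i-j, i) *)
Definition rot120 (t a x : nat) (tr : tri) : tri :=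
  let L := bigL t a x in
  let: (i, j, up) := tr in
  if up then (L - 1 - i - j, i, true) else (L - 2 - i - j, i, false).

(* reflection across the vertical symmetry axis: point (i,j) |-> (L-i-j, j) *)
Definition reflV (t a x : nat) (tr : tri) : tri :=
  let L := bigL t a x in
  let: (i, j, up) := tr in
  if up then (L - 1 - i - j, j, true) else (L - 2 - i - j, j, false).

(* central hole: up-pointing triangle of side 2x centered at the center     *)
(* (lower-left vertex (2t+2a, 2t+2a)).                                       *)
Definition in_central_hole (t a x : nat) (tr : tri) : bool :=
  in_up_triangle (2 * t + 2 * a)%:Z (2 * t + 2 * a)%:Z (2 * x)%:Z tr.

(* southern satellite hole: up-pointing triangle of side 2a on the vertical *)
(* axis below the central hole, its top vertex at distance 2y (measured in  *)
(* lattice rows) from the base of the central hole: lower-left vertex       *)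
(* (2t+2a+x+y, 2t-2y).                                                      *)
Definition in_south_hole (t y a x : nat) (tr : tri) : bool :=
  in_up_triangle (2 * t + 2 * a + x + y)%:Z ((2 * t)%:Z - (2 * y)%:Z) (2 * a)%:Z tr.

(* the three satellite holes are the southern one and its images under the  *)
(* rotations by 120 and 240 degrees (towards the NE and NW sides).          *)
Definition in_satellite_holes (t y a x : nat) (tr : tri) : bool :=
  [|| in_south_hole t y a x tr,
      in_south_hole t y a x (rot120 t a x tr) |
      in_south_hole t y a x (rot120 t a x (rot120 t a x tr))].

Definition in_H2 (t y a x : nat) (tr : tri) : bool :=
  [&& in_hexagon t a x tr, ~~ in_central_hole t a x tr & ~~ in_satellite_holes t y a x tr].

Local Open Scope fset_scope.

Definition is_tiling (R : tri -> bool) (T : {fset loz}) : Prop :=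
  (forall l, l \in T -> [&& is_lozenge l, R l.1 & R l.2]) /\
  (forall tr, R tr ->
     (exists2 l, l \in T & covers l tr) /\
     (forall l1 l2, l1 \in T -> l2 \in T -> covers l1 tr -> covers l2 tr -> l1 = l2)).

Definition map_loz (f : tri -> tri) (l : loz) : loz := (f l.1, f l.2).

Definition is_CSTC_tiling (t y a x : nat) (T : {fset loz}) : Prop :=
  [/\ is_tiling (in_H2 t y a x) T,
      [fset map_loz (rot120 t a x) l | l in T] = T &
      [fset map_loz (reflV t a x) l | l in T] = T].

(* Main.v *)
Require Import Defs.
From HB Require Import structures.
From mathcomp Require Import all_boot all_order all_algebra.
From mathcomp Require Import finmap.
From mathcomp Require Import perm.
From mathcomp Require Import zify ring.
Import Order.TTheory GRing.Theory Num.Theory.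
Set Implicit Arguments. Unset Strict Implicit. Unset Printing Implicit Defensive.

(* In barycentric coordinates the symmetry group permutes the three coordinates of a triangle. A
   triangle with two equal coordinates is fixed by a reflection, hence so is the lozenge covering it,
   and an invariant tiling amounts to a perfect matching of the triangles with strictly increasing
   coordinates. Following the two smaller coordinates, such a matching is a family of nonintersecting
   lattice paths off the diagonal, counted by a determinant of differences of binomials. Moving the
   starting points to the diagonal turns the entries into ballot numbers; the rows are indexed by two
   blocks of consecutive integers, the gap of length a being the satellite hole. The Desnanot-Jacobi
   identity, applied to the two rows next to the gap and to the outer columns, yields a recursion
   among such determinants with wider gaps, which reduces them to determinants without a gap; these
   follow from the same identity applied to the outer rows. *)

(** * Perfect matchings as nonintersecting lattice paths *)

(** The holes leave no trace in the path counts: a path that steps into one can no longer reach an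
    end point, so the diagonal is the only obstacle, and the holes merely decide which end points
    exist.

    The Desnanot-Jacobi minors without the first column have [T.+1] in place of [T], whereas the
    tilings need [T = y + w + 2 * a]. The recursion closes because at this value the row of largest
    index has a single nonzero entry, a 1 in the last column. Deleting that row and column shows
    that a determinant with parameters [w] and [T.+1] is, up to sign, the one with [w.+1] at its own
    special value of [T]. One identity then relates six determinants of the family in [y], [w], [a].
    It lowers [w] by two, so that [w = 0] and [w = 1] are both initial cases.

    The expected values are products of superfactorials of step 1, 2 or 3. Dividing the recursion by
    one of its terms cancels all but a few factorials, and an identity of rational functions
    remains. As these values are nonzero, so are the central minors, by which the identity has to be
    divided. *)

Definition east (p : nat * nat) : nat * nat := (p.1.+1, p.2).
Definition north (p : nat * nat) : nat * nat := (p.1, p.2.+1).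
Definition swap_pt (p : nat * nat) : nat * nat := (p.2, p.1).
Definition level (p : nat * nat) : nat := p.1 + p.2.
(* A point stands for an up- and for a down-pointing triangle. The down-pointing one at [p] is adjacent
   to the up-pointing ones at [neighbours p]; it is matched with [p] iff no path passes through [p]. *)
Definition neighbours (p : nat * nat) : seq (nat * nat) := [:: p; east p; north p].

Fixpoint matchings (ds us : seq (nat * nat)) : seq (seq ((nat * nat) * (nat * nat))) :=
  if ds is d :: ds' then
    flatten [seq [seq (d, u) :: m | m <- matchings ds' (rem u us)]
            | u <- [seq u <- neighbours d | u \in us]]
  else if us is [::] then [:: [::]] else [::].

Lemma size_matchings_cons d ds us :
  size (matchings (d :: ds) us) =
  \sum_(u <- neighbours d | u \in us) size (matchings ds (rem u us)).
Proof.
transitivity (size [seq (d, u) :: m | u <- [seq u <- neighbours d | u \in us],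
                                      m <- matchings ds (rem u us)]); first by [].
by rewrite size_allpairs_dep sumnE big_map big_filter.
Qed.

Lemma uniq_neighbours p : uniq (neighbours p).
Proof. case: p => j k; rewrite /= !inE /east /north !xpair_eqE /=; lia. Qed.

(** An up-pointing triangle none of whose partners is left can never be matched. This eliminates all
    choices but one at a point that no path passes. *)
Lemma matchings_stuck ds us u : uniq us -> u \in us ->
  (forall d, d \in ds -> u \notin neighbours d) -> size (matchings ds us) = 0.
Proof.
elim: ds us => [|d ds IH] us uus uin hn; first by case: us uus uin.
rewrite size_matchings_cons big_seq_cond big1 // => u' /andP [u'd u'us].
apply: IH; first exact: rem_uniq.
- rewrite mem_rem_uniq // inE uin andbT.
  by apply: contraTneq u'd => <-; apply: hn; rewrite mem_head.
- by move=> d' hd'; apply: hn; rewrite inE hd' orbT.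
Qed.

Definition lattice_paths (e p : nat * nat) : nat :=
  if (p.1 <= e.1) && (p.2 <= e.2) then 'C((e.1 - p.1) + (e.2 - p.2), e.1 - p.1) else 0.

Lemma lattice_paths_rec e p : p != e ->
  lattice_paths e p = lattice_paths e (east p) + lattice_paths e (north p).
Proof.
case: e p => a b [j k]; rewrite xpair_eqE /lattice_paths /east /north /=.
case: (ltngtP j a) => [ja|ja|->]; case: (ltngtP k b) => [kb|kb|->] //= _; rewrite ?subnn ?addn0 //.
- have [-> ->] : a - j = (a - j.+1).+1 /\ b - k = (b - k.+1).+1 by lia.
  by rewrite !addSn !addnS binS addnC.
- have -> : a - j = (a - j.+1).+1 by lia.
  by rewrite !binn.
- by rewrite !bin0.
Qed.

(* By reflection, this counts the paths from [p] to [e] that stay off the diagonal. *)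
Definition signed_paths (e p : nat * nat) : rat :=
  ((lattice_paths e p)%:R - (lattice_paths e (swap_pt p))%:R)%R.

Lemma signed_paths_rec e p : p.1 < p.2 -> e.1 < e.2 -> p != e ->
  signed_paths e p = (signed_paths e (east p) + signed_paths e (north p))%R.
Proof.
case: e p => a b [j k] /= hjk hab ne.
have ne' : swap_pt (j, k) != (a, b).
  by apply/eqP => -[] *; lia.
rewrite /signed_paths (lattice_paths_rec ne) (lattice_paths_rec ne').
rewrite /east /north /swap_pt /= !natrD; ring.
Qed.

Lemma signed_paths_diag e j : signed_paths e (j, j) = 0%R.
Proof. by rewrite /signed_paths subrr. Qed.

Lemma signed_paths_eq0 e p : p.1 <= p.2 -> e.1 <= e.2 ->
  ~~ ((p.1 <= e.1) && (p.2 <= e.2)) -> signed_paths e p = 0%R.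
Proof.
case: e p => a b [j k] /= hjk hab h; rewrite /signed_paths /lattice_paths /= (negbTE h).
by rewrite ifF ?subrr //; lia.
Qed.

Lemma signed_pathsxx e : e.1 < e.2 -> signed_paths e e = 1%R.
Proof.
case: e => a b /= hab; rewrite /signed_paths /lattice_paths /= !leqnn !subnn bin0 /=.
by rewrite ifF ?subr0 //; lia.
Qed.

Definition weakly_se (p p' : nat * nat) : bool := (p.1 <= p'.1) && (p'.2 <= p.2).

Lemma weakly_se_trans : transitive weakly_se.
Proof. by move=> [? ?] [? ?] [? ?]; rewrite /weakly_se /=; lia. Qed.

Lemma weakly_se_anti : antisymmetric weakly_se.
Proof. by move=> [? ?] [? ?]; rewrite /weakly_se /= => h; congr pair; lia. Qed.

Lemma sorted_codom n (h : 'I_n -> nat * nat) :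
  (forall r r' : 'I_n, r < r' -> weakly_se (h r) (h r')) -> sorted weakly_se (codom h).
Proof.
move=> hh; rewrite codomE sorted_pairwise; last exact: weakly_se_trans.
rewrite pairwise_map.
have : pairwise (relpre val ltn) (enum 'I_n).
  rewrite -pairwise_map val_enum_ord -sorted_pairwise ?iota_ltn_sorted //.
  exact: ltn_trans.
apply: sub_pairwise => r r' /=; exact: hh.
Qed.

(** Both families enumerate one finite set along the antisymmetric relation [weakly_se], and a
    sorted enumeration is unique. So the paths end in the order in which they start, which excludes
    a permutation sign. *)
Lemma codom_eq n (h e : 'I_n -> nat * nat) :
  injective h -> injective e -> (forall r, h r \in codom e) ->
  (forall r r' : 'I_n, r < r' -> weakly_se (h r) (h r')) ->
  (forall r r' : 'I_n, r < r' -> weakly_se (e r) (e r')) -> h =1 e.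
Proof.
move=> ih ie sub hh he.
have uh : uniq (codom h) by apply/injectiveP.
have ue : uniq (codom e) by apply/injectiveP.
have sub' : {subset codom h <= codom e} by move=> _ /codomP [r ->].
have [//|_ eqi] := uniq_min_size uh sub'; first by rewrite !size_codom.
have pe : perm_eq (codom h) (codom e) by apply: uniq_perm.
have := sorted_eq weakly_se_trans weakly_se_anti (sorted_codom hh) (sorted_codom he) pe.
rewrite !codomE => /eq_in_map E r; apply: E; exact: mem_enum.
Qed.

Lemma notin_neighbours d p : p != d -> level d <= level p -> d \notin neighbours p.
Proof.
case: d p => a b [a' b']; rewrite !inE /level /east /north !xpair_eqE /=; lia.
Qed.

(** Only a step east could break the order, and only if [d] and [p] share the first coordinate. Then
    [p] would lie strictly below [d], against either alternative: the first serves for an end point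
    [p], the second for a head still to be advanced. *)
Lemma weakly_se_step_l d p p' : p' \in [:: east d; north d] -> p != d ->
  d.1 + 2 * d.2 < p.1 + 2 * p.2 \/ level d <= level p ->
  weakly_se d p -> weakly_se p' p.
Proof.
case: d p => a b [a' b']; rewrite /weakly_se /level !inE xpair_eqE /east /north /=.
by case/orP => /eqP -> /= ne [h|h] /andP [h1 h2]; lia.
Qed.

Lemma weakly_se_step_r d p p' : p' \in [:: east d; north d] -> p != d ->
  d.1 + 2 * d.2 < p.1 + 2 * p.2 \/ level d <= level p ->
  weakly_se p d -> weakly_se p p'.
Proof.
case: d p => a b [a' b']; rewrite /weakly_se /level !inE xpair_eqE /east /north /=.
by case/orP => /eqP -> /= ne [h|h] /andP [h1 h2]; lia.
Qed.

Section PathDeterminant.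

Variables (U D : pred (nat * nat)) (n : nat) (e : 'I_n -> nat * nat).
Hypothesis inj_e : injective e.
Hypothesis sorted_e : forall r r' : 'I_n, r < r' -> weakly_se (e r) (e r').
Hypothesis mem_e : forall p, (p \in codom e) = U p && ~~ D p.
Hypothesis wedge_D : forall p, D p -> p.1 < p.2.
Hypothesis wedge_e : forall r, (e r).1 < (e r).2.
Hypothesis axis_e : forall r p, D p -> p.1 + 2 * p.2 < (e r).1 + 2 * (e r).2.
Hypothesis axis_e_eq : forall r r', (e r).1 + 2 * (e r).2 = (e r').1 + 2 * (e r').2.
Hypothesis blocked : forall p p' r, D p -> p' \in [:: east p; north p] -> ~~ U p' ->
  signed_paths (e r) p' = 0%R.

Local Notation pathmx h := (\matrix_(r, c) signed_paths (e c) (h r))%R.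

(* [h r] is the current head of the [r]-th path. Choosing the partner of the first down-pointing
   triangle of [ds] moves at most one head, and the determinant expands in the same way by linearity in
   one row. The heads stay in the order [weakly_se], which is why no sign appears. *)
Lemma size_matchings_det (ds us : seq (nat * nat)) (h : 'I_n -> nat * nat) :
  uniq ds -> sorted (fun p p' => level p <= level p') ds -> all D ds ->
  (forall d p, d \in ds -> D p -> level d < level p -> p \in ds) ->
  uniq us ->
  (forall u, (u \in us) = [&& U u, (u \in ds) || ~~ D u & u \notin codom h]) ->
  injective h -> (forall r, (h r \in ds) || (h r \in codom e)) ->
  (forall r r' : 'I_n, r < r' -> weakly_se (h r) (h r')) ->
  (forall p, p \in ds -> ~~ U p -> p \in codom h) ->
  ((size (matchings ds us))%:R = \det (pathmx h))%R.
Proof.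
elim: ds us h => [|d ds IH] us h.
  move=> _ _ _ _ uus husE ih hsub hord _.
  have he : h =1 e by apply: codom_eq => // r; have := hsub r.
  have -> : us = [::].
    apply/eqP; rewrite -size_eq0 size_eq0; apply/eqP.
    case: us uus husE => // u us _ /(_ u); rewrite mem_head /= => /esym /and3P [hU hD].
    by rewrite (eq_codom he) mem_e hU hD.
  (* The end points lie on one line [p.1 + 2 * p.2 = const], so no end point is reachable from
     another one. *)
  rewrite (_ : pathmx h = 1%:M)%R ?det1 //; apply/matrixP => r c; rewrite !mxE he.
  case: (eqVneq r c) => [->|ne]; first by rewrite signed_pathsxx.
  apply: signed_paths_eq0; rewrite ?(ltnW (wedge_e _)) //.
  have nee : e r != e c by apply: contra_neq ne => /inj_e.
  have := axis_e_eq r c; move: nee; case: (e r) (e c) => a b [a' b'] /=.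
  by rewrite xpair_eqE; lia.
rewrite /= => /andP [dnds uds] srt /andP [Dd Dds] upc uus husE ih hsub hord hstart.
have srt' : sorted (fun p p' : nat * nat => level p <= level p') ds by exact: path_sorted srt.
have dmin p : p \in ds -> level d <= level p.
  have tr : transitive (fun p p' : nat * nat => level p <= level p').
    by move=> ? ? ?; exact: leq_trans.
  by move=> pin; have /allP /(_ _ pin) := order_path_min tr srt.
have upc' d' p : d' \in ds -> D p -> level d' < level p -> p \in ds.
  move=> hd' Dp lt; have := upc d' p; rewrite !inE hd' orbT => /(_ isT Dp lt).
  case/orP => [/eqP pd|//]; move: lt; rewrite pd ltnNge dmin //.
have wd := wedge_D Dd.
rewrite -/(matchings (d :: ds) us) size_matchings_cons.
(* If [d] is a head, its own up-pointing triangle is already used; the two remaining partners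
   correspond to the two terms of [signed_paths_rec] in row [r0]. *)
case: (boolP (d \in codom h)) => [/codomP [r0 hr0]|dnh].
  have dnus : d \notin us by rewrite husE hr0 codom_f !andbF.
  have step p' : p' \in [:: east d; north d] ->
      ((if p' \in us then size (matchings ds (rem p' us)) else 0)%:R =
       \det (pathmx (fun r => if r == r0 then p' else h r)))%R.
    move=> hp'.
    have lev' : level p' = (level d).+1.
      by move: hp'; rewrite !inE /level => /orP [] /eqP ->; rewrite /= ?addSn ?addnS.
    have p'd : p' != d by apply: contra_eq_neq lev' => ->; rewrite neq_ltn ltnSn.
    case: ifP => [p'us|p'nus].
      move: (p'us); rewrite husE => /and3P [Up' dsp' p'nh].
      have p'ok : (p' \in ds) || (p' \in codom e).
        rewrite mem_e Up' /=; move: dsp'; rewrite inE (negbTE p'd) /=.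
        by case: (D p'); rewrite ?orbT ?orbF.
      apply: IH => //; first exact: rem_uniq.
      - move=> u; rewrite mem_rem_uniq // inE husE inE.
        case: (eqVneq u p') => [->|nup] /=.
          symmetry; apply/negbTE; rewrite !negb_and negbK; apply/orP; right; apply/orP; right.
          by apply/codomP; exists r0; rewrite eqxx.
        case: (eqVneq u d) => [->|nud] /=.
          by rewrite (negbTE dnds) Dd /= andbF hr0 codom_f andbF.
        congr [&& _, _ & ~~ _]; apply/codomP/codomP => -[r].
          move=> ur; exists r; case: eqP => // rr0; move: nud; rewrite ur rr0 hr0.
          by rewrite eqxx.
        by case: eqP => [_ ur|_ ur]; [move: nup; rewrite ur eqxx|exists r].
      - move=> r r'; case: (eqVneq r r0) => [->|n1]; case: (eqVneq r' r0) => [->|n2] //.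
        + by move=> E; move: p'nh; rewrite E codom_f.
        + by move=> E; move: p'nh; rewrite -E codom_f.
        + exact: ih.
      - move=> r; case: (eqVneq r r0) => [_//|n1].
        have := hsub r; rewrite inE => /orP [/orP [/eqP E|->]|->]; rewrite ?orbT //.
        by move: n1; rewrite -(inj_eq ih) E hr0 eqxx.
      - move=> r r' lt; have := hord _ _ lt.
        case: (eqVneq r r0) => [rE|n1]; case: (eqVneq r' r0) => [r'E|n2] //.
        + by move: lt; rewrite rE r'E ltnn.
        + rewrite rE -hr0; have nE : h r' != d by rewrite hr0 (inj_eq ih).
          have lb : (h r').1 + 2 * (h r').2 > d.1 + 2 * d.2 \/ level d <= level (h r').
            have /orP [] := hsub r'.
              by rewrite inE (negbTE nE) /= => /dmin; right.
            by case/codomP => c ->; left; apply: axis_e.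
          by move=> w; apply: weakly_se_step_l hp' nE lb w.
        + rewrite r'E -hr0; have nE : h r != d by rewrite hr0 (inj_eq ih).
          have lb : (h r).1 + 2 * (h r).2 > d.1 + 2 * d.2 \/ level d <= level (h r).
            have /orP [] := hsub r.
              by rewrite inE (negbTE nE) /= => /dmin; right.
            by case/codomP => c ->; left; apply: axis_e.
          by move=> w; apply: weakly_se_step_r hp' nE lb w.
      - move=> p pds nUp; have := hstart p; rewrite inE pds orbT => /(_ isT nUp).
        case/codomP => r pr; apply/codomP; exists r; case: eqP => // rr0.
        by move: dnds; rewrite hr0 -rr0 -pr pds.
    move: p'nus; rewrite husE => /negbT; rewrite !negb_and negb_or !negbK.
    have p'stuck : ~~ U p' -> (0%:R = \det (pathmx (fun r => if r == r0 then p' else h r)))%R.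
      move=> nU; symmetry; rewrite (expand_det_row _ r0) big1 // => c _.
      by rewrite !mxE eqxx (blocked _ Dd hp') // mul0r.
    case/or3P => [//|/andP [nds Dp']|/codomP [r hr]].
      by move: nds; rewrite (upc d) ?mem_head // lev'.
    have rr0 : r0 != r by apply: contra_neq p'd => E; rewrite hr -E hr0.
    symmetry; apply: (determinant_alternate rr0) => c; rewrite !mxE eqxx.
    by rewrite eq_sym (negbTE rr0) hr.
  rewrite /neighbours big_cons (negbTE dnus) big_mkcond /= !big_cons big_nil addn0.
  rewrite natrD !step ?inE ?eqxx ?orbT //.
  have := @determinant_multilinear _ _ (pathmx h)
    (pathmx (fun r => if r == r0 then east d else h r))
    (pathmx (fun r => if r == r0 then north d else h r)) r0 1%R 1%R.
  rewrite !mul1r => -> //.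
  - apply/rowP => c; rewrite !mxE !eqxx !mul1r -hr0; apply: signed_paths_rec => //.
    apply: contraTneq Dd => E; have := mem_e d; rewrite E codom_f => /esym /andP [_ /negbTE ->].
    by [].
  - by apply/matrixP => r c; rewrite !mxE eq_sym (negbTE (neq_lift _ _)).
  - by apply/matrixP => r c; rewrite !mxE eq_sym (negbTE (neq_lift _ _)).
(* If [d] is no head, its up-pointing triangle is still free. Any other choice for [d] would leave
   that triangle stuck, so [d] is matched with itself and no head moves. *)
have Ud : U d by apply: contraNT dnh => nU; apply: hstart; rewrite ?mem_head.
have dus : d \in us by rewrite husE Ud dnh mem_head.
rewrite /neighbours big_cons dus big_seq_cond big1 ?addn0.
  apply: IH => //; first exact: rem_uniq.
  - move=> u; rewrite mem_rem_uniq // inE husE inE.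
    case: (eqVneq u d) => [->|nud] //=.
    by rewrite (negbTE dnds) Dd /= andbF.
  - move=> r; have := hsub r; rewrite inE; case: (eqVneq (h r) d) => [E|//].
    by move: dnh; rewrite -E codom_f.
  - by move=> p pds; apply: hstart; rewrite inE pds orbT.
move=> u /andP [u'd uus']; apply: (matchings_stuck (u := d)); first exact: rem_uniq.
  rewrite mem_rem_uniq // inE dus andbT.
  by apply: contraTneq u'd => <-; have /= /andP [] := uniq_neighbours d.
move=> p pds; apply: notin_neighbours (dmin _ pds).
by apply: contraNneq dnds => <-.
Qed.

End PathDeterminant.

Local Open Scope ring_scope.

(** * The Desnanot-Jacobi identity *)

(** Entries come from a function on natural numbers, so that a minor is a [detn] with shifted
    arguments, without casts between ordinal types. *)
Definition detn (R : comPzRingType) n (F : nat -> nat -> R) : R :=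
  \det (\matrix_(i < n, j < n) F i j).

Lemma eq_detn (R : comPzRingType) n (F G : nat -> nat -> R) :
  (forall i j, (i < n)%N -> (j < n)%N -> F i j = G i j) -> detn n F = detn n G.
Proof. by move=> e; congr determinant; apply/matrixP => i j; rewrite !mxE e. Qed.

Lemma expand_detn (R : comPzRingType) n (F : nat -> nat -> R) i0 : (i0 < n.+1)%N ->
  detn n.+1 F = \sum_(j < n.+1) F i0 j *
    ((-1) ^+ (i0 + j) * detn n (fun i k => F (bump i0 i) (bump j k))).
Proof.
move=> hi; rewrite /detn (expand_det_row _ (Ordinal hi)); apply: eq_bigr => j _.
rewrite !mxE; congr (_ * (_ * _)); congr determinant; apply/matrixP => i k.
by rewrite !mxE.
Qed.

Lemma expand_detn1 (R : comPzRingType) n (F : nat -> nat -> R) i0 j0 :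
  (i0 < n.+1)%N -> (j0 < n.+1)%N ->
  (forall j, (j < n.+1)%N -> j != j0 -> F i0 j = 0) ->
  detn n.+1 F = F i0 j0 * ((-1) ^+ (i0 + j0) * detn n (fun i k => F (bump i0 i) (bump j0 k))).
Proof.
move=> hi hj hF; rewrite (expand_detn _ hi) (bigD1 (Ordinal hj)) //= big1 ?addr0 // => j ne.
by rewrite hF ?mul0r.
Qed.

(** Expand along row [i0], whose cofactors do not see that row. Another row paired with these
    cofactors gives an off-diagonal entry of the matrix times its adjugate, which is zero. *)
Lemma detn_row_op (R : comPzRingType) n (F F' : nat -> nat -> R) i0 (c : nat -> R) :
  (i0 < n)%N -> c i0 = 0 ->
  (forall i j, (i < n)%N -> (j < n)%N -> i != i0 -> F' i j = F i j) ->
  (forall j, (j < n)%N -> F' i0 j = F i0 j + \sum_(k < n) c k * F k j) ->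
  detn n F' = detn n F.
Proof.
move=> hi c0 hF hF0; rewrite /detn.
set A := \matrix_(i, j) F i j; set A' := \matrix_(i, j) F' i j; pose i1 := Ordinal hi.
have cofE j : cofactor A' i1 j = cofactor A i1 j.
  congr (_ * \det _); apply/matrixP => i k; rewrite !mxE hF //.
  by have := neq_lift i1 i; rewrite -val_eqE eq_sym.
rewrite (expand_det_row A' i1) (expand_det_row A i1).
have -> : \sum_j A' i1 j * cofactor A' i1 j =
   \sum_j A i1 j * cofactor A i1 j + \sum_(k < n) c k * (\sum_j A k j * cofactor A i1 j).
  have -> : \sum_(k < n) c k * (\sum_j A k j * cofactor A i1 j) =
            \sum_j \sum_(k < n) c k * (A k j * cofactor A i1 j).
    by rewrite exchange_big; apply: eq_bigr => k _; rewrite mulr_sumr.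
  rewrite -big_split /=; apply: eq_bigr => j _.
  rewrite cofE !mxE /= hF0 // mulrDl mulr_suml; congr (_ + _).
  by apply: eq_bigr => k _; rewrite !mxE mulrA.
rewrite [X in _ + X]big1 ?addr0 // => k _.
have [->|ne] := eqVneq (k : nat) i0; first by rewrite c0 mul0r.
have := congr1 (fun M : 'M_n => M k i1) (mul_mx_adj A).
rewrite !mxE -val_eqE /= (negbTE ne) mulr0n => E.
rewrite (_ : \sum_j _ = 0) ?mulr0 // -[RHS]E; apply: eq_bigr => j _.
by rewrite !mxE.
Qed.

Lemma detn_solve (K : fieldType) n (B : nat -> nat -> K) (r : nat -> K) : detn n B != 0 ->
  exists c : nat -> K, forall j, (j < n)%N -> r j + \sum_(k < n) c k * B k j = 0.
Proof.
rewrite /detn; set M := (\matrix_(i, j) _) => dM.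
have uM : M \in unitmx by rewrite unitmxE unitfE.
pose v := - (\row_(j < n) r j) *m invmx M.
exists (fun k => if (insub k : option 'I_n) is Some k' then v 0 k' else 0) => j hj.
have := congr1 (fun A : 'rV[K]_n => A 0 (Ordinal hj)) (mulmxKV uM (- (\row_(j < n) r j))).
rewrite -/v !mxE => E; rewrite -[RHS](subrr (r j)); congr (_ + _); rewrite -E.
by apply: eq_bigr => k _; rewrite valK [M _ _]mxE.
Qed.

Section DesnanotJacobi.

Variables (K : fieldType) (n : nat) (F : nat -> nat -> K).

(** Since the central minor is invertible, adding combinations of the inner rows to the two outer
    ones makes the inner entries of the latter vanish. None of the six determinants changes, and all
    but the central one become corner entries times the central one. *)
Lemma desnanot_jacobi :
  detn n (fun i j => F i.+1 j.+1) != 0 ->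
  detn n.+2 F * detn n (fun i j => F i.+1 j.+1) =
  detn n.+1 F * detn n.+1 (fun i j => F i.+1 j.+1)
  - detn n.+1 (fun i j => F i.+1 j) * detn n.+1 (fun i j => F i j.+1).
Proof.
move=> d0.
have [c cE] := detn_solve (fun j => F 0%N j.+1) d0.
have [c' c'E] := detn_solve (fun j => F n.+1 j.+1) d0.
(* [e f] puts the coefficients [f] on the inner rows 1 to [n] and zero on the two outer rows. *)
pose e (f : nat -> K) k := if (0 < k <= n)%N then f k.-1 else 0.
pose G i j := if i == 0%N then F 0%N j + \sum_(k < n) c k * F k.+1 j else
              if i == n.+1 then F n.+1 j + \sum_(k < n) c' k * F k.+1 j else F i j.
have sumS (f f' : nat -> K) : \sum_(k < n) e f k.+1 * f' k.+1 = \sum_(k < n) f k * f' k.+1.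
  by apply: eq_bigr => k _; rewrite /e /= ltn_ord.
have G1 j : G 0%N j = F 0%N j + \sum_(k < n) c k * F k.+1 j by [].
have Gn j : G n.+1 j = F n.+1 j + \sum_(k < n) c' k * F k.+1 j by rewrite /G /= eqxx.
have Gi i j : (0 < i <= n)%N -> G i j = F i j.
  by rewrite /G; case: i => //= i hi; rewrite ifF //; apply/negbTE; lia.
have Gi1 i j : (i < n)%N -> G i.+1 j = F i.+1 j by move=> h; rewrite Gi.
pose G' i j := if i == 0%N then F 0%N j + \sum_(k < n) c k * F k.+1 j else F i j.
have EG : detn n.+2 G = detn n.+2 F.
  transitivity (detn n.+2 G').
    apply: (@detn_row_op _ _ _ _ n.+1 (e c')); rewrite ?ltnSn //.
    - by rewrite /e ltnn andbF.
    - by move=> i j hi hj ne; rewrite /G /G' (negbTE ne).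
    - move=> j hj; rewrite Gn /G' /= big_ord_recl big_ord_recr /=.
      rewrite {1}/e /= mul0r add0r /bump /= [e c' n.+1]/e ltnn mul0r addr0; congr (_ + _).
      by rewrite -(sumS c' (F^~ j)); apply: eq_bigr => k _; rewrite add1n.
  apply: (@detn_row_op _ _ _ _ 0%N (e c)) => //.
    by move=> i j hi hj ne; rewrite /G' (negbTE ne).
  move=> j hj; rewrite /G' /= big_ord_recl big_ord_recr /=.
  rewrite {1}/e /= mul0r add0r /bump /= [e c n.+1]/e ltnn mul0r addr0; congr (_ + _).
  by rewrite -(sumS c (F^~ j)); apply: eq_bigr => k _; rewrite add1n.
have ES s : detn n.+1 (fun i j => G i.+1 (s j)) = detn n.+1 (fun i j => F i.+1 (s j)).
  apply: (@detn_row_op _ _ _ _ n (fun k => e c' k.+1)) => //.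
  - by rewrite /e ltnn andbF.
  - by move=> i j hi hj ne; apply: Gi; lia.
  - move=> j hj; rewrite Gn big_ord_recr /= [e c' n.+1]/e ltnn mul0r addr0; congr (_ + _).
    by rewrite -(sumS c' (F^~ (s j))).
have E0 s : detn n.+1 (fun i j => G i (s j)) = detn n.+1 (fun i j => F i (s j)).
  apply: (@detn_row_op _ _ _ _ 0%N (e c)) => //.
  - by move=> i j hi hj ne; apply: Gi; lia.
  - move=> j hj; rewrite G1 big_ord_recl /= {1}/e /= mul0r add0r; congr (_ + _).
    by rewrite -(sumS c (F^~ (s j))); apply: eq_bigr => k _; rewrite /bump.
have Bi : detn n (fun i j => G i.+1 j.+1) = detn n (fun i j => F i.+1 j.+1).
  by apply: eq_detn => i j hi hj; rewrite Gi1.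
rewrite -EG -(ES id) -(ES S) -(E0 id) -(E0 S) -Bi.
have z0 j : (j < n)%N -> G 0%N j.+1 = 0 by move=> h; rewrite G1 cE.
have zn j : (j < n)%N -> G n.+1 j.+1 = 0 by move=> h; rewrite Gn c'E.
set B := detn n _.
have e00 : detn n.+1 (fun i j => G i (id j)) = G 0%N 0%N * B.
  rewrite (@expand_detn1 _ _ _ 0%N 0%N) //= ?expr0 ?mul1r //.
  by case=> // j hj _; rewrite z0.
have e11 : detn n.+1 (fun i j => G i.+1 j.+1) = G n.+1 n.+1 * B.
  rewrite (@expand_detn1 _ _ _ n n) //=; last by move=> j hj ne; apply: zn; lia.
  rewrite addnn -mul2n mulnC exprM sqrr_sign mul1r; congr (_ * _); apply: eq_detn => i j hi hj.
  by rewrite /bump [(n <= i)%N]leqNgt hi [(n <= j)%N]leqNgt hj.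
have e10 : detn n.+1 (fun i j => G i.+1 (id j)) = G n.+1 0%N * ((-1) ^+ n * B).
  rewrite (@expand_detn1 _ _ _ n 0%N) //=.
    rewrite addn0; congr (_ * (_ * _)); apply: eq_detn => i j hi hj.
    by rewrite /bump leqNgt hi.
  by case=> // j hj _; rewrite zn.
have e01 : detn n.+1 (fun i j => G i j.+1) = G 0%N n.+1 * ((-1) ^+ n * B).
  rewrite (@expand_detn1 _ _ _ 0%N n) //=; last by move=> j hj ne; apply: z0; lia.
  rewrite add0n; congr (_ * (_ * _)); apply: eq_detn => i j hi hj.
  by rewrite /bump [(n <= j)%N]leqNgt hj.
have e2 : detn n.+2 G = G 0%N 0%N * (G n.+1 n.+1 * B) +
    G 0%N n.+1 * ((-1) ^+ n.+1 * (G n.+1 0%N * ((-1) ^+ n * B))).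
  rewrite (@expand_detn _ _ _ 0%N) // big_ord_recl big_ord_recr /= big1 ?add0r; last first.
    by move=> j _; rewrite /bump /= add1n z0 ?mul0r.
  rewrite expr0 mul1r -e11 -e10 /bump /= add1n add0n; congr (_ + _); congr (_ * (_ * _)).
  by apply: eq_detn => i j hi hj; rewrite [(n < j)%N]ltnNge -ltnS hj.
rewrite e2 e00 e11 e10 e01.
have -> : (-1 : K) ^+ n.+1 = - (-1) ^+ n by rewrite exprS mulN1r.
have s2 : (-1 : K) ^+ n * (-1) ^+ n = 1 by rewrite -expr2 sqrr_sign.
by ring: s2.
Qed.

End DesnanotJacobi.

(** * Product formulas *)

Definition fac (m : nat) : rat := m`!%:R.
(** This is $2^m (2m-1)!!$, so that its quotients express skipped Pochhammer symbols with odd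
    argument. *)
Definition dfac (m : nat) : rat := fac (2 * m) / fac m.

Lemma fac_neq0 m : fac m != 0.
Proof. by rewrite /fac pnatr_eq0 -lt0n fact_gt0. Qed.

Lemma facS m : fac m.+1 = m.+1%:R * fac m.
Proof. by rewrite /fac factS natrM. Qed.

Lemma dfac_neq0 m : dfac m != 0.
Proof. by rewrite /dfac mulf_neq0 ?invr_eq0 ?fac_neq0. Qed.

Lemma dfacS m : dfac m.+1 = (2 * (2 * m).+1)%:R * dfac m.
Proof.
rewrite /dfac mulnS !facS natrM (_ : (2 * m).+2%:R = 2%:R * m.+1%:R :> rat); last first.
  by rewrite -natrM; congr _%:R; lia.
by field; rewrite fac_neq0 nat1r pnatr_eq0.
Qed.

(* [f (m - s) * f (m - 2 s) * ...], as long as the arguments are nonnegative: a superfactorial for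
   [s = 1] and [f = fac]. *)
Definition stepprod (s : nat) (f : nat -> rat) (m : nat) : rat :=
  \prod_(j < m %/ s) f (m %% s + s * j)%N.

Lemma stepprod_add s f m m' : (0 < s)%N -> m' = (m + s)%N ->
  stepprod s f m' = f m * stepprod s f m.
Proof.
move=> s0 ->; rewrite /stepprod divnDr ?dvdnn // divnn s0 addn1 modnDr big_ord_recr /= mulrC.
by congr (f _ * _); rewrite [RHS](divn_eq m s) addnC mulnC.
Qed.

Arguments stepprod_add {s f m m'}.

Lemma stepprod_neq0 s f m : (forall k, f k != 0) -> stepprod s f m != 0.
Proof. by move=> f0; apply/prodf_neq0 => j _; apply: f0. Qed.

Lemma stepprod_small s f m : (m < s)%N -> stepprod s f m = 1.
Proof. by move=> h; rewrite /stepprod divn_small // big_ord0. Qed.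

Notation H1 := (stepprod 1 fac).
Notation H2 := (stepprod 2 fac).
Notation H3 := (stepprod 3 fac).
Notation D1 := (stepprod 1 dfac).
Notation D3 := (stepprod 3 dfac).

Lemma H_neq0 s m : stepprod s fac m != 0.
Proof. exact: stepprod_neq0 fac_neq0. Qed.

Lemma D_neq0 s m : stepprod s dfac m != 0.
Proof. exact: stepprod_neq0 dfac_neq0. Qed.

Lemma H2_mul m : H2 m * H2 m.+1 = H1 m.
Proof.
elim: m => [|m IH]; first by rewrite !stepprod_small // mulr1.
rewrite [H2 m.+2](stepprod_add (m := m)) ?addn2 // [H1 m.+1](stepprod_add (m := m)) ?addn1 //.
by rewrite -IH; ring.
Qed.

Lemma D1_H1 m : D1 m * H1 m = H2 (2 * m).
Proof.
elim: m => [|m IH]; first by rewrite !stepprod_small // mulr1.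
rewrite [D1 m.+1](stepprod_add (m := m)) ?addn1 // [H1 m.+1](stepprod_add (m := m)) ?addn1 //.
rewrite [H2 _](stepprod_add (m := (2 * m)%N)) //; last by lia.
by rewrite -IH /dfac; field; rewrite fac_neq0.
Qed.

Lemma H2_even_odd m : H2 (2 * m).+2 = 2%:R ^+ m * fac m * H2 (2 * m).+1.
Proof.
elim: m => [|m IH].
  by rewrite muln0 (stepprod_add (m := 0%N)) // !stepprod_small // /fac fact0 !mulr1.
rewrite (stepprod_add (m := (2 * m).+2)) //; last by lia.
rewrite [in RHS](stepprod_add (m := (2 * m).+1)) //; last by lia.
rewrite IH !facS exprS (_ : (2 * m).+2%:R = 2%:R * m.+1%:R :> rat); first by ring.
by rewrite -natrM; congr _%:R; lia.
Qed.

(** The part of [gap_product] that depends on [X] alone. It cancels from the recursion; its value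
    makes [gap_product X 0 0 0] equal to 1. *)
Definition prefactor (X : nat) : rat := H2 (2 * X) / (D3 X * H3 (2 * X).+1).

Lemma prefactor_neq0 X : prefactor X != 0.
Proof. by rewrite /prefactor mulf_neq0 ?invr_eq0 ?mulf_neq0 ?H_neq0 ?D_neq0. Qed.

(** Needed for [w = 0], with [v = y + a]: it trades the products of step 3 for one of step 2.
    Raising [v] by one shifts every argument by whole steps, so the induction compares finitely many
    factorials. *)
Lemma prefactor_even X v :
  prefactor X * 2%:R ^+ v * D3 (X + 3 * v) * H3 (X + 3 * v).+1 * H3 (2 * X + 6 * v).+1 =
  H3 X.+1 * H2 (2 * X + 6 * v).
Proof.
elim: v => [|v IH].
  by rewrite !muln0 !addn0 /prefactor; field; rewrite D_neq0 H_neq0.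
rewrite [D3 _](stepprod_add (m := (X + 3 * v)%N)) //; last by lia.
rewrite [H3 (X + _).+1](stepprod_add (m := (X + 3 * v).+1)) //; last by lia.
rewrite [H3 (2 * X + _).+1](stepprod_add (m := (2 * X + 6 * v).+4)) //; last by lia.
rewrite [H3 (2 * X + _).+4](stepprod_add (m := (2 * X + 6 * v).+1)) //; last by lia.
rewrite [H2 _](stepprod_add (m := (2 * X + 6 * v).+4)) //; last by lia.
rewrite [H2 _.+4](stepprod_add (m := (2 * X + 6 * v).+2)) //; last by lia.
rewrite [H2 _.+2](stepprod_add (m := (2 * X + 6 * v)%N)) //; last by lia.
set m := (X + 3 * v)%N in IH *; have E : (2 * X + 6 * v = 2 * m)%N by rewrite /m; lia.
rewrite !E in IH *.
have -> : fac (2 * m).+2 = 2%:R * m.+1%:R * fac (2 * m).+1.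
  by rewrite facS -natrM; congr (_%:R * _); lia.
rewrite /dfac exprS (facS m).
transitivity (prefactor X * 2%:R ^+ v * D3 m * H3 m.+1 * H3 (2 * m).+1 *
   (2%:R * m.+1%:R * (fac (2 * m) * fac (2 * m).+1 * fac (2 * m).+4))).
  by field; rewrite fac_neq0.
by rewrite IH; ring.
Qed.

(** The counterpart for [w = 1]. The arguments of step 2 are now odd, and [H2_even_odd] brings in
    the power of two. *)
Lemma prefactor_odd X v :
  prefactor X * D3 (X + 3 * v).+3 * H3 (X + 3 * v).+1 * H3 (2 * X + 6 * v).+4 =
  2%:R ^+ (X + 2 * v) * H3 X.+1 * H2 (2 * X + 6 * v).+3.
Proof.
elim: v => [|v IH].
  rewrite !muln0 !addn0 /prefactor.
  rewrite [D3 _.+3](stepprod_add (m := X)) ?addn3 //.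
  rewrite [H3 _.+4](stepprod_add (m := (2 * X).+1)) ?addn3 //.
  rewrite [H2 _.+3](stepprod_add (m := (2 * X).+1)) ?addn2 //.
  have E := H2_even_odd X; rewrite (stepprod_add (m := (2 * X)%N)) ?addn2 // in E.
  have -> : H2 (2 * X) = 2%:R ^+ X * fac X * H2 (2 * X).+1 / fac (2 * X).
    by rewrite -E; field; rewrite fac_neq0.
  by rewrite /dfac; field; rewrite !fac_neq0 D_neq0 H_neq0.
rewrite [D3 _](stepprod_add (m := (X + 3 * v).+3)) //; last by lia.
rewrite [H3 (X + _).+1](stepprod_add (m := (X + 3 * v).+1)) //; last by lia.
rewrite [H3 (2 * X + 6 * v.+1).+4](stepprod_add (m := (2 * X + 6 * v).+4.+3)) //; last by lia.
rewrite [H3 _.+4.+3](stepprod_add (m := (2 * X + 6 * v).+4)) //; last by lia.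
rewrite [H2 (2 * X + 6 * v.+1).+3](stepprod_add (m := (2 * X + 6 * v).+4.+3)) //; last by lia.
rewrite [H2 _.+4.+3](stepprod_add (m := (2 * X + 6 * v).+4.+1)) //; last by lia.
rewrite [H2 _.+4.+1](stepprod_add (m := (2 * X + 6 * v).+3)) //; last by lia.
rewrite (_ : (X + 2 * v.+1)%N = (X + 2 * v).+2); last by lia.
set m := (X + 3 * v)%N in IH *; have E : (2 * X + 6 * v = 2 * m)%N by rewrite /m; lia.
rewrite !E in IH *.
have -> : fac (2 * m).+4.+1 = (2 * m).+4.+1%:R * fac (2 * m).+4 by rewrite facS.
have -> : dfac m.+3 = 2%:R * 2%:R * (2 * m).+4.+1%:R * fac (2 * m).+3 / fac m.+1.
  rewrite /dfac (_ : (2 * m.+3)%N = (2 * m).+4.+2); last by lia.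
  rewrite !facS.
  have -> : (2 * m).+4.+2%:R = 2%:R * m.+3%:R :> rat by rewrite -natrM; congr _%:R; lia.
  have -> : (2 * m).+4%:R = 2%:R * m.+2%:R :> rat by rewrite -natrM; congr _%:R; lia.
  by field; rewrite fac_neq0 nat1r -!natrD !pnatr_eq0.
rewrite !exprS.
transitivity (prefactor X * D3 m.+3 * H3 m.+1 * H3 (2 * m).+4 *
   (2%:R * 2%:R * ((2 * m).+4.+1%:R * fac (2 * m).+4 * fac (2 * m).+3 * fac (2 * m).+4.+3))).
  by field; rewrite fac_neq0.
by rewrite IH; ring.
Qed.

(* The recursions relate products at four arguments; [cross] is multiplicative, so that they can be
   checked factor by factor. *)
Definition cross (a b c d : rat) : rat := c * d / (a * b).

Lemma crossM a b c d a' b' c' d' :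
  cross (a * a') (b * b') (c * c') (d * d') = cross a b c d * cross a' b' c' d'.
Proof. by rewrite /cross !invfM; ring. Qed.

Lemma crossV a b c d : cross a^-1 b^-1 c^-1 d^-1 = (cross a b c d)^-1.
Proof. by rewrite /cross !invfM !invrK. Qed.

Lemma crossC a b c d : cross a b c d = cross a b d c.
Proof. by rewrite /cross [c * d]mulrC. Qed.

Lemma crossC2 a b c d : cross a b c d = cross b a c d.
Proof. by rewrite /cross [a * b]mulrC. Qed.

Lemma cross_id a b : a != 0 -> b != 0 -> cross a b a b = 1.
Proof. by move=> a0 b0; rewrite /cross divff ?mulf_neq0. Qed.

(** In the recursions the four arguments of a product either agree in pairs or differ by one step as
    here, and then a single quotient of two values of [f] survives. *)
Lemma cross_shift s f (a b c d : nat) : (0 < s)%N -> (forall k, f k != 0) ->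
  c = (a + s)%N -> b = (d + s)%N ->
  cross (stepprod s f a) (stepprod s f b) (stepprod s f c) (stepprod s f d) = f a / f d.
Proof.
move=> s0 f0 -> ->; rewrite /cross !(stepprod_add s0 (erefl _)).
by field; rewrite f0 !stepprod_neq0.
Qed.

Lemma cross_stepprod_id s f (a b c d : nat) : (forall k, f k != 0) -> a = c -> b = d ->
  cross (stepprod s f a) (stepprod s f b) (stepprod s f c) (stepprod s f d) = 1.
Proof. by move=> f0 -> ->; rewrite cross_id ?stepprod_neq0. Qed.

Lemma fac_up a d : a = d.+1 -> fac a / fac d = a%:R.
Proof. by move=> ->; rewrite facS mulfK ?fac_neq0. Qed.

Lemma fac_down a d : d = a.+1 -> fac a / fac d = d%:R^-1.
Proof. by move=> ->; rewrite facS invfM mulrCA divff ?fac_neq0 ?mulr1. Qed.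

Lemma dfac_up a d : a = d.+1 -> dfac a / dfac d = (2 * (2 * d).+1)%:R.
Proof. by move=> ->; rewrite dfacS mulfK ?dfac_neq0. Qed.

Lemma dfac_down a d : d = a.+1 -> dfac a / dfac d = (2 * (2 * a).+1)%:R^-1.
Proof. by move=> ->; rewrite dfacS invfM mulrCA divff ?dfac_neq0 ?mulr1. Qed.

Lemma fac_ratio_up a d k : a = d.+1 -> k = a -> fac a / fac d = k%:R.
Proof. by move=> h ->; apply: fac_up. Qed.

Lemma fac_ratio_down a d k : d = a.+1 -> k = d -> fac a / fac d = k%:R^-1.
Proof. by move=> h ->; apply: fac_down. Qed.

Lemma dfac_ratio_up a d k : a = d.+1 -> k = (2 * (2 * d).+1)%N -> dfac a / dfac d = k%:R.
Proof. by move=> h ->; apply: dfac_up. Qed.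

Lemma dfac_ratio_down a d k : d = a.+1 -> k = (2 * (2 * a).+1)%N -> dfac a / dfac d = k%:R^-1.
Proof. by move=> h ->; apply: dfac_down. Qed.

Lemma cross_exp (i j k l : nat) : (i + j = k + l)%N ->
  cross (2%:R ^+ i) (2%:R ^+ j) (2%:R ^+ k) (2%:R ^+ l) = 1.
Proof. by move=> e; rewrite /cross -!exprD e divff // expf_neq0. Qed.

Ltac split_factors := repeat match goal with
  | |- (?a * ?b)%R = (?c * ?d)%R => refine (f_equal2 GRing.mul _ _)
  | |- (?a ^-1)%R = (?c ^-1)%R => refine (f_equal GRing.inv _)
  end.

Ltac nonzero := first [exact: fac_neq0 | exact: dfac_neq0 | exact: prefactor_neq0].
Ltac ratio := first [apply: fac_ratio_up; lia | apply: fac_ratio_down; lia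
                   | apply: dfac_ratio_up; lia | apply: dfac_ratio_down; lia].
Ltac shift := rewrite cross_shift; [ratio | done | nonzero | lia | lia].
Ltac same := apply: cross_stepprod_id; [nonzero | lia | lia].
Ltac factor := first
  [ same | rewrite crossC; same | apply: cross_exp; lia | by rewrite cross_id
  | shift | rewrite crossC; shift | rewrite crossC2; shift | rewrite crossC crossC2; shift ].

Definition gap_product (X y w a : nat) : rat :=
  prefactor X * 2%:R ^+ (y + w + a) *
  (D1 (w + a) * H1 y * H1 a / (D1 w * D1 (y + w + a) * H1 (y + a))) *
  (H3 (2 * X + 3 * y + 3 * w + 6 * a).+1 * D3 (X + 3 * y + 3 * w + 3 * a)
   / D1 (X + 2 * y + 2 * w + 3 * a)) *
  (H2 (X + 3 * y + 2 * w + 4 * a) * H2 (X + y + 2 * w + 2 * a)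
   / (H2 (X + 3 * y + 2 * w + 2 * a) * H2 (X + y + 2 * w + 4 * a))) *
  (H2 (X + y + 2 * a).+1 * H2 (X + 3 * y).+1 * H3 (X + 3 * y + 3 * a).+1
   / (H2 (X + y).+1 * H2 (X + 3 * y + 2 * a).+1 * H3 (X + 3 * y).+1)) *
  (H1 (X + 2 * y + w + 2 * a) / (H1 (X + 2 * y + w + 3 * a) * H1 (X + y + w + 2 * a))).

Lemma gap_product_neq0 X y w a : gap_product X y w a != 0.
Proof.
by rewrite /gap_product !(mulf_neq0, invr_eq0) ?prefactor_neq0 ?H_neq0 ?D_neq0 ?expf_neq0.
Qed.

(** One term of the recursion divided by its left-hand side. The right-hand side keeps the shape of
    [gap_product], ones included, so that [split_factors] can pair the factors. *)
Lemma gap_product_cross1 X y z a :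
  cross (gap_product X y.+1 z.+2 a) (gap_product X y z a.+2) (gap_product X y z.+2 a.+1) (gap_product X y.+1 z a.+1) =
  1 * 1 *
  ((2 * (2 * (z + a + 1)).+1)%:R * 1 * (a.+1)%:R^-1 / (1 * 1 * 1)) *
  (1 * 1 / (2 * (2 * (X + 2 * y + 2 * z + 3 * a + 5)).+1)%:R) *
  (1 * (X + y + 2 * z + 2 * a + 4)%:R / ((X + 3 * y + 2 * z + 2 * a + 5)%:R^-1 * 1)) *
  ((X + y + 2 * a + 3)%:R^-1 * 1 * 1 / (1 * (X + 3 * y + 2 * a + 4)%:R * 1)) *
  (1 / ((X + 2 * y + z + 3 * a + 5)%:R^-1 * 1)).
Proof.
rewrite /gap_product; move: (prefactor X) (prefactor_neq0 X) => c c0.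
by rewrite !(crossM, crossV); split_factors; factor.
Qed.

Lemma gap_product_cross2 X y z a :
  cross (gap_product X y.+1 z.+2 a) (gap_product X y z a.+2) (gap_product X y z.+1 a.+1) (gap_product X y.+1 z.+1 a.+1) =
  1 * 1 *
  (1 * 1 * (a.+1)%:R^-1 / ((2 * (2 * z).+1)%:R^-1 * 1 * 1)) *
  (1 * 1 / (2 * (2 * (X + 2 * y + 2 * z + 3 * a + 5)).+1)%:R) *
  ((X + 3 * y + 2 * z + 4 * a + 7)%:R * 1 / (1 * (X + y + 2 * z + 4 * a + 6)%:R^-1)) *
  ((X + y + 2 * a + 3)%:R^-1 * 1 * 1 / (1 * (X + 3 * y + 2 * a + 4)%:R * 1)) *
  ((X + 2 * y + z + 2 * a + 4)%:R / (1 * 1)).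
Proof.
rewrite /gap_product; move: (prefactor X) (prefactor_neq0 X) => c c0.
by rewrite !(crossM, crossV); split_factors; factor.
Qed.

(** This is the Desnanot-Jacobi recursion once every determinant at [T.+1] has been read as one with
    an additional lower row; hence the [z.+2] and the absence of [T]. *)
Lemma gap_product_rec X y z a :
  gap_product X y.+1 z.+2 a * gap_product X y z a.+2 =
  gap_product X y z.+2 a.+1 * gap_product X y.+1 z a.+1 - gap_product X y z.+1 a.+1 * gap_product X y.+1 z.+1 a.+1.
Proof.
have n0 : gap_product X y.+1 z.+2 a * gap_product X y z a.+2 != 0 by rewrite mulf_neq0 ?gap_product_neq0.
apply/(mulIf (invr_neq0 n0)); rewrite mulrBl mulfV //.
have E1 := gap_product_cross1 X y z a; have E2 := gap_product_cross2 X y z a.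
rewrite {1}/cross in E1; rewrite {1}/cross in E2; rewrite E1 E2.

by field; rewrite -!(natrM, natrD) !nat1r !pnatr_eq0; lia.
Qed.

(** * Products for the determinants without a gap *)

Lemma H1_split m : H1 m = H2 m * H2 m.+1.
Proof. by rewrite H2_mul. Qed.

Lemma D1_even m : D1 m = H2 (2 * m) / H1 m.
Proof. by rewrite -D1_H1 mulfK ?H_neq0. Qed.

Definition block_product (X T n : nat) : rat :=
  H1 n * (H2 (2 * T + X + n) / H2 (2 * T + X - n)) * (H1 (T + X + n) / H1 (T + X + 2 * n)) *
  (H2 (T - n) / H2 (T + n)) * (H2 (X + 3 * n).+1 / H2 (X + n).+1) *
  (H3 X.+1 / H3 (X + 3 * n).+1) * (H2 (3 * T + 2 * X + 3 * n) / H2 (3 * T + 2 * X + n)) *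
  (H3 (3 * T + 2 * X).+1 / H3 (3 * T + 2 * X + 3 * n).+1).

Lemma block_product_neq0 X T n : block_product X T n != 0.
Proof. by rewrite /block_product !(mulf_neq0, invr_eq0) ?H_neq0. Qed.

Lemma block_product0 X T : block_product X T 0 = 1.
Proof. by rewrite /block_product !muln0 !addn0 !subn0 !divff ?H_neq0 // !mulr1 stepprod_small. Qed.

(** Writing [T = k + 3 + d] makes every truncated subtraction in the three terms of the recursion a
    genuine one. *)
Lemma block_product_cross1 X k d (T := (k + 3 + d)%N) :
  cross (block_product X T k.+2) (block_product X.+3 T.-1 k) (block_product X T k.+1) (block_product X.+3 T.-1 k.+1) =
  k.+1%:R^-1 * (1 / (X + k + 2 * d + 5)%:R^-1) * ((X + 2 * k + d + 5)%:R / 1) *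
  (1 / (2 * k + d + 3)%:R^-1) * (1 / (X + k + 3)%:R) *
  (1 / 1) * (1 / (2 * X + 4 * k + 3 * d + 11)%:R) * (1 / 1).
Proof. by rewrite /block_product /T !(crossM, crossV); split_factors; factor. Qed.

Lemma block_product_cross2 X k d (T := (k + 3 + d)%N) :
  cross (block_product X T k.+2) (block_product X.+3 T.-1 k) (block_product X.+3 T.-2 k.+1) (block_product X T.+1 k.+1) =
  k.+1%:R^-1 * ((X + 3 * k + 2 * d + 7)%:R / 1) * (1 / (X + 3 * k + d + 6)%:R^-1) *
  ((d.+1)%:R / 1) * (1 / (X + k + 3)%:R) *
  (1 / 1) * (1 / (2 * X + 4 * k + 3 * d + 11)%:R) * (1 / 1).
Proof. by rewrite /block_product /T !(crossM, crossV); split_factors; factor. Qed.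

Lemma block_product_rec X k d (T := (k + 3 + d)%N) :
  block_product X T k.+2 * block_product X.+3 T.-1 k =
  block_product X T k.+1 * block_product X.+3 T.-1 k.+1 - block_product X.+3 T.-2 k.+1 * block_product X T.+1 k.+1.
Proof.
have n0 : block_product X T k.+2 * block_product X.+3 T.-1 k != 0 by rewrite mulf_neq0 ?block_product_neq0.
apply/(mulIf (invr_neq0 n0)); rewrite mulrBl mulfV //.
have E1 := block_product_cross1 X k d; have E2 := block_product_cross2 X k d.
rewrite {1}/cross in E1; rewrite {1}/cross in E2; rewrite E1 E2.
by field; rewrite -!(natrM, natrD) !nat1r !pnatr_eq0; lia.
Qed.

(** The counterpart of [blockdet_diag] for the products. Arguments of [H2] of both parities meet
    here; [H2_even_odd] reduces them to one parity. *)
Lemma block_product_diag X k : block_product X k.+1 k.+1 = block_product X k.+1 k.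
Proof.
apply/(mulIf (invr_neq0 (block_product_neq0 X k.+1 k))); rewrite mulfV ?block_product_neq0 //.
rewrite /block_product !subnn; have -> : (k.+1 - k = 1)%N by lia.
rewrite [H2 0]stepprod_small // [H2 1]stepprod_small //.
have -> : (2 * k.+1 + X - k.+1 = X + k.+1)%N by lia.
have -> : (2 * k.+1 + X - k = (X + k.+1).+1)%N by lia.
have -> : (2 * k.+1 + X + k.+1 = X + 3 * k + 3)%N by lia.
have -> : (2 * k.+1 + X + k = X + 3 * k + 2)%N by lia.
have -> : (k.+1 + X + k.+1 = X + 2 * k + 2)%N by lia.
have -> : (k.+1 + X + k = X + 2 * k + 1)%N by lia.
have -> : (k.+1 + X + 2 * k.+1 = X + 3 * k + 3)%N by lia.
have -> : (k.+1 + X + 2 * k = X + 3 * k + 1)%N by lia.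
have -> : (X + 3 * k.+1 = X + 3 * k + 3)%N by lia.
have -> : (3 * k.+1 + 2 * X + 3 * k.+1 = 2 * X + 6 * k + 6)%N by lia.
have -> : (3 * k.+1 + 2 * X + k.+1 = 2 * X + 4 * k + 4)%N by lia.
have -> : (3 * k.+1 + 2 * X + 3 * k = 2 * X + 6 * k + 3)%N by lia.
have -> : (3 * k.+1 + 2 * X + k = 2 * X + 4 * k + 3)%N by lia.
rewrite (_ : (k.+1 + k.+1)%N = (2 * k).+2); last by lia.
rewrite (_ : (k.+1 + k)%N = (2 * k).+1); last by lia.
rewrite (_ : (2 * X + 6 * k + 6 = (2 * (X + 3 * k).+1).+4)%N); last by lia.
rewrite (_ : (2 * X + 6 * k + 3 = (2 * (X + 3 * k).+1).+1)%N); last by lia.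
rewrite (_ : (2 * X + 4 * k + 4 = (2 * (X + 2 * k).+1).+2)%N); last by lia.
rewrite (_ : (2 * X + 4 * k + 3 = (2 * (X + 2 * k).+1).+1)%N); last by lia.
rewrite (_ : (X + 2 * k + 2 = (X + 2 * k).+2)%N); last by lia.
rewrite (_ : (X + 2 * k + 1 = (X + 2 * k).+1)%N); last by lia.
rewrite (_ : (X + 3 * k + 3 = (X + 3 * k).+3)%N); last by lia.
rewrite (_ : (X + 3 * k + 2 = (X + 3 * k).+2)%N); last by lia.
rewrite (_ : (X + 3 * k + 1 = (X + 3 * k).+1)%N); last by lia.
rewrite (_ : (X + k.+1 = (X + k).+1)%N); last by lia.
rewrite (_ : (3 * k.+1 + 2 * X = 2 * X + 3 * k + 3)%N); last by lia.
rewrite [H1 k.+1](stepprod_add (m := k)) ?addn1 //.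
rewrite [H1 (X + 2 * k).+2](stepprod_add (m := (X + 2 * k).+1)) ?addn1 //.
rewrite [H1 (X + 3 * k).+3]H1_split [H1 (X + 3 * k).+1]H1_split.
rewrite [H3 (X + 3 * k).+4](stepprod_add (m := (X + 3 * k).+1)) ?addn3 //.
rewrite [H2 (2 * (X + 3 * k).+1).+4](stepprod_add (m := (2 * (X + 3 * k).+1).+2)) ?addn2 //.
rewrite [H3 (2 * (X + 3 * k).+1).+4.+1](stepprod_add (m := (2 * (X + 3 * k).+1).+2)) ?addn3 //.
rewrite !H2_even_odd.
have -> : 2%:R ^+ (X + 3 * k).+1 = 2%:R ^+ (X + 2 * k).+1 * 2%:R ^+ k :> rat.
  by rewrite -exprD; congr (_ ^+ _); lia.
field; rewrite !H_neq0 !fac_neq0 !expf_neq0 //.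
Qed.

Lemma D1_odd m : D1 m.+1 = 2%:R ^+ m * H2 (2 * m).+1 / H1 m.
Proof.
rewrite D1_even mulnS H2_even_odd [H1 m.+1](stepprod_add (m := m)) ?addn1 //.
by field; rewrite fac_neq0 H_neq0.
Qed.

(** With an empty lower block, [a] enters the determinant only through [T = y + 2 * a]. *)
Lemma gap_product_w0 X y a : gap_product X y 0 a = block_product X (y + 2 * a) y.
Proof.
rewrite /gap_product /block_product !muln0 !addn0 add0n.
have E := prefactor_even X (y + a).
rewrite (_ : (X + 3 * (y + a) = X + 3 * y + 3 * a)%N) in E; last by lia.
rewrite (_ : (2 * X + 6 * (y + a) = 2 * X + 6 * y + 6 * a)%N) in E; last by lia.
have -> : (2 * (y + 2 * a) + X + y = X + 3 * y + 4 * a)%N by lia.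
have -> : (2 * (y + 2 * a) + X - y = X + y + 4 * a)%N by lia.
have -> : (y + 2 * a + X + y = X + 2 * y + 2 * a)%N by lia.
have -> : (y + 2 * a + X + 2 * y = X + 3 * y + 2 * a)%N by lia.
have -> : (y + 2 * a - y = 2 * a)%N by lia.
have -> : (y + 2 * a + y = 2 * (y + a))%N by lia.
have -> : (3 * (y + 2 * a) + 2 * X + 3 * y = 2 * X + 6 * y + 6 * a)%N by lia.
have -> : (3 * (y + 2 * a) + 2 * X + y = 2 * (X + 2 * y + 3 * a))%N by lia.
have -> : (3 * (y + 2 * a) + 2 * X = 2 * X + 3 * y + 6 * a)%N by lia.
rewrite [D1 0]stepprod_small // [H1 (X + y + 2 * a)]H1_split [H1 (X + 3 * y + 2 * a)]H1_split.
rewrite !D1_even.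
have {}E : prefactor X * 2%:R ^+ (y + a) = H3 X.+1 * H2 (2 * X + 6 * y + 6 * a) /
   (D3 (X + 3 * y + 3 * a) * H3 (X + 3 * y + 3 * a).+1 * H3 (2 * X + 6 * y + 6 * a).+1).
  by rewrite -E; field; rewrite !H_neq0 !D_neq0.
by rewrite E; field; rewrite !H_neq0 !D_neq0.
Qed.

(** Dropping the single lower row leaves a determinant without a gap whose [T] is larger by one. *)
Lemma gap_product_w1 X y a : gap_product X y 1 a = block_product X (y + 2 * a + 1) y.
Proof.
rewrite /gap_product /block_product !muln1.
have E := prefactor_odd X (y + a).
rewrite (_ : (X + 3 * (y + a)).+3 = (X + 3 * y + 3 * a).+3) in E; last by lia.
rewrite (_ : (X + 3 * (y + a)).+1 = (X + 3 * y + 3 * a).+1) in E; last by lia.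
rewrite (_ : (2 * X + 6 * (y + a)).+4 = (2 * X + 6 * y + 6 * a).+4) in E; last by lia.
rewrite (_ : (2 * X + 6 * (y + a)).+3 = (2 * X + 6 * y + 6 * a).+3) in E; last by lia.
have -> : (2 * (y + 2 * a + 1) + X + y = X + 3 * y + 2 + 4 * a)%N by lia.
have -> : (2 * (y + 2 * a + 1) + X - y = X + y + 2 + 4 * a)%N by lia.
have -> : (y + 2 * a + 1 + X + y = X + 2 * y + 1 + 2 * a)%N by lia.
have -> : (y + 2 * a + 1 + X + 2 * y = (X + 3 * y + 2 * a).+1)%N by lia.
have -> : (y + 2 * a + 1 - y = (2 * a).+1)%N by lia.
have -> : (y + 2 * a + 1 + y = (2 * (y + a)).+1)%N by lia.
have -> : (3 * (y + 2 * a + 1) + 2 * X + 3 * y = (2 * X + 6 * y + 6 * a).+3)%N by lia.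
have -> : (3 * (y + 2 * a + 1) + 2 * X + y = (2 * (X + 2 * y + 3 * a).+1).+1)%N by lia.
have -> : (3 * (y + 2 * a + 1) + 2 * X = 2 * X + 3 * y + 3 + 6 * a)%N by lia.
have -> : (1 + a = a.+1)%N by lia.
have -> : (y + 1 + a = (y + a).+1)%N by lia.
have -> : (X + 3 * y + 3 + 3 * a = (X + 3 * y + 3 * a).+3)%N by lia.
have -> : (X + 2 * y + 2 + 3 * a = (X + 2 * y + 3 * a).+2)%N by lia.
have -> : (X + y + 2 + 2 * a = (X + y + 2 * a).+2)%N by lia.
have -> : (X + 3 * y + 2 + 2 * a = (X + 3 * y + 2 * a).+2)%N by lia.
have -> : (X + y + 1 + 2 * a = (X + y + 2 * a).+1)%N by lia.
have -> : (X + 2 * y + 1 + 3 * a = (X + 2 * y + 3 * a).+1)%N by lia.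
rewrite [H1 (X + y + 2 * a).+1]H1_split [H1 (X + 3 * y + 2 * a).+1]H1_split.
have D11 : D1 1 = 1.
  by rewrite (stepprod_add (m := 0%N)) // stepprod_small // /dfac /fac muln0 fact0 divff // mulr1.
rewrite D11 !D1_odd.
have {}E : prefactor X = 2%:R ^+ (X + 2 * (y + a)) * H3 X.+1 * H2 (2 * X + 6 * y + 6 * a).+3 /
   (D3 (X + 3 * y + 3 * a).+3 * H3 (X + 3 * y + 3 * a).+1 * H3 (2 * X + 6 * y + 6 * a).+4).
  by rewrite -E; field; rewrite !H_neq0 !D_neq0.
rewrite E.
have -> : 2%:R ^+ (X + 2 * (y + a)) = 2%:R ^+ X * 2%:R ^+ y ^+ 2 * 2%:R ^+ a ^+ 2 :> rat.
  by rewrite -!exprM -!exprD; congr (_ ^+ _); lia.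
have -> : 2%:R ^+ (X + 2 * y + 3 * a).+1 = 2%:R * 2%:R ^+ X * 2%:R ^+ y ^+ 2 * 2%:R ^+ a ^+ 3 :> rat.
  by rewrite -!exprM exprS -!mulrA -!exprD; congr (_ * _ ^+ _); lia.
have -> : 2%:R ^+ (y + a).+1 = 2%:R * 2%:R ^+ y * 2%:R ^+ a :> rat.
  by rewrite exprS exprD mulrA.
rewrite [2%:R ^+ (y + a)]exprD.
have p2 k : 2%:R ^+ k != 0 :> rat by rewrite expf_neq0.
move: (p2 X) (p2 y) (p2 a).
move: (2%:R ^+ X : rat) (2%:R ^+ y : rat) (2%:R ^+ a : rat) => bX by_ ba nX ny na.
by field; rewrite !H_neq0 !D_neq0 nX ny na.
Qed.

Lemma prefactor_shift X a : prefactor (X + 3 * a) = prefactor X * 2%:R ^+ a * H3 (X + 3 * a).+1 / H3 X.+1.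
Proof.
have E := prefactor_even X a; rewrite [LHS]/prefactor.
rewrite (_ : (2 * (X + 3 * a) = 2 * X + 6 * a)%N); last by lia.
have -> : H2 (2 * X + 6 * a) = (H3 X.+1 * H2 (2 * X + 6 * a)) / H3 X.+1.
  by field; rewrite H_neq0.
by rewrite -E; field; rewrite !H_neq0 D_neq0.
Qed.

(** With an empty upper block the gap is a mere shift of the row indices, which [X + 3 * a] absorbs.
    By the case [w = 0] the right-hand side is itself a value of [gap_product], so only two such
    values have to be compared. *)
Lemma gap_product_y0 X w a : gap_product X 0 w a = block_product (X + 3 * a) w w.
Proof.
have -> : block_product (X + 3 * a) w w = gap_product (X + 3 * a) w 0 0 by rewrite gap_product_w0 muln0 addn0.
rewrite /gap_product !muln0 !addn0 !add0n.
rewrite prefactor_shift [D1 0]stepprod_small // [H1 0]stepprod_small //.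
have -> : (2 * (X + 3 * a) + 3 * w = 2 * X + 3 * w + 6 * a)%N by lia.
have -> : (X + 3 * a + 3 * w = X + 3 * w + 3 * a)%N by lia.
have -> : (X + 3 * a + 2 * w = X + 2 * w + 3 * a)%N by lia.
have -> : (X + 3 * a + w = X + w + 3 * a)%N by lia.
rewrite exprD.
by field; rewrite !H_neq0 !D_neq0.
Qed.

(** * The formula $P_1$ in terms of superfactorials *)

Local Arguments intmul : simpl never.

Lemma prod_fac p m : \prod_(k < m) (p + k).+1%:R = fac (p + m) / fac p.
Proof.
elim: m => [|m IH]; first by rewrite big_ord0 addn0 divff ?fac_neq0.
by rewrite big_ord_recr /= IH addnS facS; ring.
Qed.

(** The convention for negative orders is the one that preserves the quotient of factorials. It is
    needed, since orders such as [y - i + 1] may be negative in $P_1$. *)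
Lemma poch_fac (b n : int) (p q : nat) : b = p.+1 -> b + n = q.+1 ->
  poch b%:~R n = fac q / fac p.
Proof.
move=> -> {b}; case: n => m /= e.
  have -> : q = (p + m)%N by lia.
  by rewrite -prod_fac; apply: eq_bigr => k _; rewrite -natrD addSn.
have -> : p = (q + m.+1)%N by lia.
rewrite -[RHS]invrK invfM invrK mulrC -prod_fac; congr _^-1.
rewrite (reindex_inj rev_ord_inj) /=; apply: eq_bigr => k _.
rewrite -(@natrB _ (q + m.+1).+1); last by have := ltn_ord k; lia.
by congr _%:R; have := ltn_ord k; lia.
Qed.

Lemma spoch_dfac (b n : int) (u m : nat) : b = (2 * u).+1 -> n = m ->
  spoch b%:~R n = dfac (u + m) / (2%:R ^+ m * dfac u).
Proof.
move=> -> -> {b n} /=; elim: m => [|m IH].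
  by rewrite big_ord0 addn0 expr0 mul1r divff ?dfac_neq0.
rewrite big_ord_recr /= IH addnS dfacS -natrD exprS natrM.
rewrite (_ : ((2 * u).+1 + 2 * m)%N = (2 * (u + m)).+1); last by lia.
by field; rewrite dfac_neq0 expf_neq0.
Qed.

Local Arguments poch : simpl never.
Local Arguments spoch : simpl never.

Lemma gap_product_00 Y w : gap_product Y 0 w 0 =
  prefactor Y * 2%:R ^+ w * (D1 w)^-1 * (H3 (2 * Y + 3 * w).+1 * D3 (Y + 3 * w) / D1 (Y + 2 * w))
  * (H1 (Y + w))^-1.
Proof.
rewrite /gap_product !muln0 !addn0 !add0n [H1 0]stepprod_small //.
by field; rewrite !H_neq0 !D_neq0.
Qed.

Lemma dfac_odd m : dfac m.+1 = 2%:R * fac (2 * m).+1 / fac m.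
Proof.
rewrite /dfac mulnS !facS (_ : (2 * m).+2%:R = 2%:R * m.+1%:R :> rat); last first.
  by rewrite -natrM; congr _%:R; lia.
by field; rewrite fac_neq0 nat1r pnatr_eq0.
Qed.

(** With [Y = X + 3 * a] and [N = y + z], the first product of $P_1$ is the value of [gap_product]
    for the same size without satellite holes. What remains of $P_1$ is then a quotient of two
    values of [gap_product]. *)
Lemma P1_first_prod Y N :
  (2%:R ^+ N)^-1 * \prod_(k < N)
    (poch (2 * (Y.+1)%:Z + 2 * k.+1%:Z)%:~R k.+1%:Z *
     spoch (2 * (Y.+1)%:Z + 4 * k.+1%:Z + 1)%:~R (k.+1%:Z - 1) /
     (poch k.+1%:Z%:~R k.+1%:Z * spoch (2 * (Y.+1)%:Z + 2 * k.+1%:Z + 1)%:~R (k.+1%:Z - 1))) =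
  gap_product Y 0 N.+1 0.
Proof.
elim: N => [|N IH].
  by rewrite big_ord0 expr0 invr1 mulr1 gap_product_y0 muln0 addn0 block_product_diag block_product0.
rewrite big_ord_recr /= exprS invfM [2^-1 * _]mulrC mulrACA IH !gap_product_00.
rewrite (@poch_fac _ _ (2 * Y + 2 * N + 3) (2 * Y + 3 * N + 4)); try lia.
rewrite (@poch_fac _ _ N (2 * N).+1); try lia.
rewrite (@spoch_dfac _ _ (Y + 2 * N + 3) N); try lia.
rewrite (@spoch_dfac _ _ (Y + N).+2 N); try lia.
rewrite [D1 N.+2](stepprod_add (m := N.+1)) ?addn1 //.
rewrite [H3 (2 * Y + 3 * N.+2).+1](stepprod_add (m := (2 * Y + 3 * N.+1).+1)) //; last by lia.
rewrite [D3 (Y + 3 * N.+2)](stepprod_add (m := (Y + 3 * N.+1)%N)) //; last by lia.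
rewrite [D1 (Y + 2 * N.+2)](stepprod_add (m := (Y + 2 * N.+1).+1)) //; last by lia.
rewrite [D1 (Y + 2 * N.+1).+1](stepprod_add (m := (Y + 2 * N.+1)%N)) //; last by lia.
rewrite [H1 (Y + N.+2)](stepprod_add (m := (Y + N.+1)%N)) //; last by lia.
rewrite (_ : (2 * Y + 3 * N + 4)%N = (2 * Y + 3 * N.+1).+1); last by lia.
rewrite (_ : (Y + 2 * N + 3 + N)%N = (Y + 3 * N.+1)%N); last by lia.
rewrite (_ : (Y + 2 * N + 3)%N = (Y + 2 * N.+1).+1); last by lia.
rewrite (_ : ((Y + N).+2 + N)%N = (Y + 2 * N.+1)%N); last by lia.
rewrite (_ : (2 * Y + 2 * N + 3)%N = (2 * (Y + N.+1)).+1); last by lia.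
rewrite (_ : (Y + N).+2 = (Y + N.+1).+1); last by lia.
rewrite [dfac N.+1]dfac_odd [dfac (Y + N.+1).+1]dfac_odd !exprS.
by field; rewrite !H_neq0 !D_neq0 !dfac_neq0 !fac_neq0 expf_neq0.
Qed.

Lemma prod_stepprod s c a : (0 < s)%N ->
  \prod_(k < a) fac (c + s * k) = stepprod s fac (c + s * a) / stepprod s fac c.
Proof.
move=> s0; elim: a => [|a IH]; first by rewrite big_ord0 muln0 addn0 divff ?H_neq0.
rewrite big_ord_recr /= IH [in RHS](stepprod_add (m := (c + s * a)%N)) //; last by lia.
by ring.
Qed.

Lemma prod_stepprod_rev s c a : (0 < s)%N ->
  \prod_(k < a) fac (c + s * (a - k.+1)) = stepprod s fac (c + s * a) / stepprod s fac c.
Proof. by move=> s0; rewrite -prod_stepprod // [RHS](reindex_inj rev_ord_inj). Qed.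

Lemma P1_gap_product X y z a :
  P1 (X + 1)%N%:Z y%:Z z%:Z a%:Z = gap_product X y z.+1 a.
Proof.
rewrite /P1 /iprod -PoszD !big_add1 /= !big_mkord.
pose Y := (X + 3 * a)%N.
have -> : gap_product X y z.+1 a = gap_product Y 0 (y + z).+1 0 * (gap_product X y z.+1 a / gap_product Y 0 (y + z).+1 0).
  by rewrite mulrCA divff ?mulr1 // gap_product_neq0.
congr (_ * _).
  rewrite -P1_first_prod; congr (_ * _); apply: eq_bigr => k _.
  by congr (poch _%:~R _ * spoch _%:~R _ / (_ * spoch _%:~R _)); rewrite /Y; lia.
(* Each Pochhammer symbol becomes a quotient of factorials with arguments in arithmetic progression,
   of step 1, 2 or 3 and increasing or decreasing in [k]. The product over [k] thus consists of
   quotients of [stepprod]. *)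
rewrite (eq_bigr (fun k : 'I_a =>
  fac ((z + y) + 1 * (a - k.+1)) / fac (z + 1 * k) *
  (fac ((X + 3 * y + 2 * z + 2 * a + 2) + 2 * (a - k.+1)) / fac ((X + y + 2 * z + 2 * a + 2) + 2 * k)) *
  (fac ((X + y).+1 + 2 * k) / fac (X.+1 + 3 * k)) *
  (fac ((X + 3 * y).+1 + 3 * k) / fac ((X + 3 * y).+1 + 2 * k)) /
  (fac (y + 1 * k) / fac (0 + 1 * k) *
   (fac ((2 * (y + z)).+1 + 2 * (a - k.+1)) / fac ((y + 2 * z) + 2 * k)) *
   (fac ((y + 2 * z) + 2 * (a - k.+1)) / fac ((2 * z).+1 + 2 * k)) *
   (fac ((X + 2 * y + z + 2 * a).+1 + 1 * (a - k.+1)) / fac ((X + y + z + 2 * a).+1 + 1 * k))))); last first.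
  move=> k _; have hk := ltn_ord k.
  congr (_ * _ * _ * _ / (_ * _ * _ * _)); apply: poch_fac; lia.
do ![rewrite big_split /= | rewrite prodfV].
rewrite !prod_stepprod ?prod_stepprod_rev //.
rewrite gap_product_00 /gap_product /Y prefactor_shift !mul1n add0n [H1 0]stepprod_small //.
have -> : (X + 3 * y + 2 * z + 2 * a + 2 + 2 * a = X + 3 * y + 2 * z.+1 + 4 * a)%N by lia.
have -> : (X + 3 * y + 2 * z + 2 * a + 2 = X + 3 * y + 2 * z.+1 + 2 * a)%N by lia.
have -> : (X + y + 2 * z + 2 * a + 2 + 2 * a = X + y + 2 * z.+1 + 4 * a)%N by lia.
have -> : (X + y + 2 * z + 2 * a + 2 = X + y + 2 * z.+1 + 2 * a)%N by lia.
have -> : ((X + y).+1 + 2 * a = (X + y + 2 * a).+1)%N by lia.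
have -> : (X.+1 + 3 * a = (X + 3 * a).+1)%N by lia.
have -> : ((X + 3 * y).+1 + 3 * a = (X + 3 * y + 3 * a).+1)%N by lia.
have -> : ((X + 3 * y).+1 + 2 * a = (X + 3 * y + 2 * a).+1)%N by lia.
have -> : ((2 * (y + z)).+1 + 2 * a = (2 * (y + z + a)).+1)%N by lia.
have -> : ((2 * z).+1 + 2 * a = (2 * (z + a)).+1)%N by lia.
have -> : ((X + 2 * y + z + 2 * a).+1 + a = X + 2 * y + z.+1 + 3 * a)%N by lia.
have -> : (X + 2 * y + z + 2 * a).+1 = (X + 2 * y + z.+1 + 2 * a)%N by lia.
have -> : ((X + y + z + 2 * a).+1 + a = X + 3 * a + (y + z).+1)%N by lia.
have -> : (X + y + z + 2 * a).+1 = (X + y + z.+1 + 2 * a)%N by lia.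
have -> : (z.+1 + a = (z + a).+1)%N by lia.
have -> : (y + z.+1 + a = (y + z + a).+1)%N by lia.
have -> : (2 * (X + 3 * a) + 3 * (y + z).+1 = 2 * X + 3 * y + 3 * z.+1 + 6 * a)%N by lia.
have -> : (X + 3 * a + 3 * (y + z).+1 = X + 3 * y + 3 * z.+1 + 3 * a)%N by lia.
have -> : (X + 3 * a + 2 * (y + z).+1 = X + 2 * y + 2 * z.+1 + 3 * a)%N by lia.
have -> : (z + y + a = y + z + a)%N by lia.
have -> : (z + y = y + z)%N by lia.
rewrite [D1 (z + a).+1]D1_odd [D1 z.+1]D1_odd [D1 (y + z + a).+1]D1_odd [D1 (y + z).+1]D1_odd.
rewrite !exprS ![2%:R ^+ (_ + a)]exprD.
have p2 k : 2%:R ^+ k != 0 :> rat by rewrite expf_neq0.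
move: (p2 (y + z)%N) (p2 z) (p2 a) (prefactor_neq0 X).
move: (prefactor X) (2%:R ^+ (y + z) : rat) (2%:R ^+ z : rat) (2%:R ^+ a : rat) => cx bN bz ba nN nz na ncx.
field; rewrite !H_neq0 !D_neq0 ?nN ?nz ?na ?ncx //.
Qed.

(** * Evaluation of the ballot determinants *)

(** The ballot number $\binom{E+N}{E}-\binom{E+N}{E-1}$ with $E=e+1-2s$ steps east and $N=e+X+s-1$
    steps north. Here [s] numbers the end points and [e] the starting points; the test covers
    negative $E$, where truncated subtraction would be wrong. *)
Definition ballot_entry (X s e : nat) : rat :=
  if (2 * s <= e.+1)%N then
    (X + 3 * s - 1)%N%:R * fac (2 * e + X - s) / (fac (e.+1 - 2 * s) * fac (e + X + s))
  else 0.

Lemma ballot_entry_eq0 X s e : (e.+1 < 2 * s)%N -> ballot_entry X s e = 0.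
Proof. by rewrite /ballot_entry ltnNge => /negbTE ->. Qed.

(** This keeps the minors without the first row within the family: the shifted row index is absorbed
    by [X] and [T]. *)
Lemma ballot_entry_shift X r s e : ballot_entry X (r + s) (e + 2 * r) = ballot_entry (X + 3 * r) s e.
Proof.
rewrite /ballot_entry; have -> : (2 * (r + s) <= (e + 2 * r).+1)%N = (2 * s <= e.+1)%N by lia.
case: ifP => // h.
by congr (_%:R * fac _ / (fac _ * fac _)); lia.
Qed.

Lemma ballot_entry_last X s e : (0 < s)%N -> e.+1 = (2 * s)%N -> ballot_entry X s e = 1.
Proof.
move=> s0 h; rewrite /ballot_entry h leqnn subnn.
have -> : (e + X + s = (X + 3 * s - 1))%N by lia.
have -> : (2 * e + X - s = (X + 3 * s - 1).-1)%N by lia.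
have : (0 < X + 3 * s - 1)%N by lia.
case: (X + 3 * s - 1)%N => // m _ /=.
by rewrite -facS {2}/fac fact0 mul1r divff ?fac_neq0.
Qed.

Definition blockdet X T n : rat := detn n (fun i j => ballot_entry X i.+1 (T + j)).

(** For [T] equal to the size, the last row vanishes except for a 1 in the last column. *)
Lemma blockdet_diag X n : blockdet X n.+1 n.+1 = blockdet X n.+1 n.
Proof.
rewrite /blockdet (@expand_detn1 _ _ _ n n) //; last first.
  by move=> j hj ne; apply: ballot_entry_eq0; lia.
rewrite ballot_entry_last //; last by lia.
rewrite mul1r addnn -mul2n mulnC exprM sqrr_sign mul1r; apply: eq_detn => i j hi hj.
by rewrite /bump [(n <= i)%N]leqNgt hi [(n <= j)%N]leqNgt hj.
Qed.

Lemma blockdet1 X T : blockdet X T.+1 1 = block_product X T.+1 1.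
Proof.
rewrite /blockdet (@expand_detn1 _ _ _ 0 0) //; last by case.
rewrite /detn det_mx00 !mulr1 addn0 /ballot_entry /block_product.
rewrite [H1 1](stepprod_add (m := 0%N)) // [H1 0]stepprod_small //.
rewrite (_ : (2 * T.+1 + X + 1)%N = (2 * T.+1 + X - 1).+2); last by lia.
rewrite [H2 (_ - 1).+2](stepprod_add (m := (2 * T.+1 + X - 1)%N)); [|by []|by lia].
rewrite [H1 (T.+1 + X + 2 * 1)](stepprod_add (m := (T.+1 + X + 1)%N)); [|by []|by lia].
rewrite [H2 (T.+1 + 1)](stepprod_add (m := (T.+1 - 1)%N)); [|by []|by lia].
rewrite [H2 (X + 3 * 1).+1](stepprod_add (m := (X + 1).+1)); [|by []|by lia].
rewrite [H3 (X + 3 * 1).+1](stepprod_add (m := X.+1)); [|by []|by lia].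
rewrite [H2 (3 * T.+1 + 2 * X + 3 * 1)](stepprod_add (m := (3 * T.+1 + 2 * X + 1)%N)); [|by []|by lia].
rewrite [H3 (3 * T.+1 + 2 * X + 3 * 1).+1](stepprod_add (m := (3 * T.+1 + 2 * X).+1)); [|by []|by lia].
rewrite (_ : (X + 3 * 1 - 1)%N = X.+2); last by lia.
rewrite (_ : (T.+2 - 2 * 1)%N = (T.+1 - 1)%N); last by lia.
have f0 : fac 0 = 1 by rewrite /fac fact0.
rewrite !addn1 [fac X.+2]facS f0 (_ : (2 * 1 <= T.+2)%N = true) //.
by field; rewrite !H_neq0 !fac_neq0.
Qed.

(** The minor without the first row and the last column has [T.-2] and size [n.-1], so it satisfies
    the bound only if [n < T]; the case [n = T] is reduced by [blockdet_diag] instead. *)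
Lemma blockdet_block_product X T n : (n <= T)%N -> blockdet X T n = block_product X T n.
Proof.
elim/ltn_ind: n X T => n IH X T; case: n IH => [|n] IH hn.
  by rewrite block_product0 /blockdet /detn det_mx00.
move: hn; rewrite leq_eqVlt => /orP [/eqP <-|hn].
  by rewrite blockdet_diag block_product_diag IH.
case: n IH hn => [|k] IH hn.
  by case: T hn => // T _; exact: blockdet1.
have [d Td] : exists d, T = (k + 3 + d)%N by exists (T - (k + 3))%N; lia.
have sh T' n' i0 j0 (T1 : nat) : (T' + j0 = T1 + 2)%N -> i0 = 1%N -> 
    detn n' (fun i j => ballot_entry X (i0 + i).+1 (T' + (j0 + j))) = blockdet X.+3 T1 n'.
  move=> e -> ; apply: eq_detn => i j hi hj.
  rewrite (_ : (1 + i).+1 = (1 + i.+1)%N) //.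
  rewrite (_ : (T' + (j0 + j) = T1 + j + 2 * 1)%N); last by lia.
  by rewrite ballot_entry_shift muln1 addn3.
have E1 : detn k (fun i j => ballot_entry X i.+2 (T + j.+1)) = blockdet X.+3 T.-1 k.
  by apply: (sh T k 1%N 1%N) => //; lia.
have E2 : detn k.+1 (fun i j => ballot_entry X i.+2 (T + j.+1)) = blockdet X.+3 T.-1 k.+1.
  by apply: (sh T k.+1 1%N 1%N) => //; lia.
have E3 : detn k.+1 (fun i j => ballot_entry X i.+2 (T + j)) = blockdet X.+3 T.-2 k.+1.
  by apply: (sh T k.+1 1%N 0%N) => //; lia.
have E4 : detn k.+1 (fun i j => ballot_entry X i.+1 (T + j.+1)) = blockdet X T.+1 k.+1.
  by apply: eq_detn => i j hi hj; rewrite addnS addSn.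
have n0 : blockdet X.+3 T.-1 k != 0 by rewrite IH ?block_product_neq0 //; lia.
have := @desnanot_jacobi _ k (fun i j => ballot_entry X i.+1 (T + j)).
rewrite E1 E2 E3 E4 => /(_ n0); rewrite -!/(blockdet _ _ _) => DJ.
apply: (mulIf n0); rewrite DJ !IH; try lia.
by rewrite Td -block_product_rec.
Qed.

(* The lower block comes first, so that the Desnanot-Jacobi identity deletes the rows next to the gap. *)
Definition gap_row (y w a i : nat) : nat := if (i < w)%N then (y + a + i).+1 else (i - w).+1.

Definition gapdet X T y w a : rat := detn (y + w) (fun i j => ballot_entry X (gap_row y w a i) (T + j)).

(** Row [w] carries the largest index [y + a + w.+1], and at this [T] its only nonzero entry is the
    last one. The sign arises because [y] rows follow it. *)
Lemma gapdet_drop X y w a :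
  gapdet X (y + w.+1 + 2 * a) y w.+1 a = (-1) ^+ y * gapdet X (y + w + 2 * a).+1 y w a.
Proof.
rewrite /gapdet addnS (@expand_detn1 _ _ _ w (y + w)%N); first last.
- move=> j hj ne; rewrite /gap_row ltnSn; apply: ballot_entry_eq0; lia.
- lia.
- lia.
rewrite /gap_row ltnSn ballot_entry_last //; last by lia.
rewrite mul1r addnCA addnn exprD -mul2n mulnC exprM sqrr_sign mulr1; congr (_ * _).
apply: eq_detn => i j hi hj; congr ballot_entry; last first.
  rewrite /bump [(_ <= j)%N]leqNgt hj; lia.
rewrite /bump; case: (ltnP i w) => h; first by rewrite add0n ltnS ltnW.
by rewrite ifF; lia.
Qed.

Lemma gapdet_rec X T y z a : gapdet X T.+1 y z a.+2 != 0 ->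
  gapdet X T y.+1 z.+1 a * gapdet X T.+1 y z a.+2 =
  gapdet X T y z.+1 a.+1 * gapdet X T.+1 y.+1 z a.+1
  - gapdet X T y.+1 z a.+1 * gapdet X T.+1 y z.+1 a.+1.
Proof.
pose F i j := ballot_entry X (gap_row y.+1 z.+1 a i) (T + j).
have r1 i : gap_row y.+1 z.+1 a i.+1 = gap_row y.+1 z a.+1 i.
  by rewrite /gap_row ltnS subSS; case: ifP => _ //; lia.
have r2 i : (i < (y + z).+1)%N -> gap_row y.+1 z.+1 a i = gap_row y z.+1 a.+1 i.
  by rewrite /gap_row => h; case: ifP => _ //; lia.
have r3 i : (i < y + z)%N -> gap_row y.+1 z.+1 a i.+1 = gap_row y z a.+2 i.
  by rewrite r1 /gap_row => h; case: ifP => _ //; lia.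
have -> : gapdet X T y.+1 z.+1 a = detn (y + z).+2 F by rewrite /gapdet addSn addnS.
have -> : gapdet X T.+1 y z a.+2 = detn (y + z) (fun i j => F i.+1 j.+1).
  by apply: eq_detn => i j hi hj; rewrite /F r3 // addSnnS.
have -> : gapdet X T y z.+1 a.+1 = detn (y + z).+1 F.
  by rewrite /gapdet addnS; apply: eq_detn => i j hi hj; rewrite /F r2.
have -> : gapdet X T.+1 y.+1 z a.+1 = detn (y + z).+1 (fun i j => F i.+1 j.+1).
  by rewrite /gapdet addSn; apply: eq_detn => i j hi hj; rewrite /F r1 addSnnS.
have -> : gapdet X T y.+1 z a.+1 = detn (y + z).+1 (fun i j => F i.+1 j).
  by rewrite /gapdet addSn; apply: eq_detn => i j hi hj; rewrite /F r1.
have -> : gapdet X T.+1 y z.+1 a.+1 = detn (y + z).+1 (fun i j => F i j.+1).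
  by rewrite /gapdet addnS; apply: eq_detn => i j hi hj; rewrite /F r2 // addSnnS.
exact: desnanot_jacobi.
Qed.

Lemma gapdet_y0 X T w a : (2 * a <= T)%N -> gapdet X T 0 w a = blockdet (X + 3 * a) (T - 2 * a) w.
Proof.
move=> h; apply: eq_detn => i j hi hj; rewrite -ballot_entry_shift /gap_row hi; congr ballot_entry; lia.
Qed.

Lemma gapdet_w0 X T y a : gapdet X T y 0 a = blockdet X T y.
Proof. by rewrite /gapdet addn0; apply: eq_detn => i j hi hj; rewrite /gap_row subn0. Qed.

(** The sign is that of moving the [w] lower rows back past the [y] upper ones. The induction is on
    the size [y + w]. *)
Lemma gapdet_gap_product X y w a :
  gapdet X (y + w + 2 * a) y w a = (-1) ^+ (y * w) * gap_product X y w a.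
Proof.
elim/ltn_ind: {y w}(y + w)%N {-2}y {-2}w (erefl (y + w)%N) a => n IH y w yw a.
have sgn_neq0 k : (-1) ^+ k != 0 :> rat by rewrite signr_eq0.
have IH1 y' w' a' : (y' + w' < n)%N ->
    gapdet X (y' + w' + 2 * a') y' w' a' = (-1) ^+ (y' * w') * gap_product X y' w' a'.
  by move=> h; apply: (IH (y' + w')%N).
(* A determinant at [T.+1] is evaluated as one with an additional lower row, hence the stronger
   bound [n.-1]. *)
have IH2 y' w' a' : (y' + w' < n.-1)%N ->
    gapdet X (y' + w' + 2 * a').+1 y' w' a' = (-1) ^+ (y' * w') * gap_product X y' w'.+1 a'.
  move=> h; apply: (mulfI (sgn_neq0 y')); rewrite -gapdet_drop IH1; last by lia.
  by rewrite mulnS exprD -mulrA.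
case: y IH IH1 IH2 yw => [|y] IH IH1 IH2 yw.
  rewrite gapdet_y0 ?leq_addl // addnK add0n mul1r gap_product_y0 blockdet_block_product //.
case: w yw => [|[|z]] yw.
- by rewrite gapdet_w0 muln0 mul1r addn0 gap_product_w0 blockdet_block_product //; lia.
- rewrite gapdet_drop addn0 gapdet_w0 muln1 gap_product_w1 blockdet_block_product; last by lia.
  by rewrite addn1.
rewrite gapdet_drop.
have e T1 T2 y' w' a' : T1 = T2 -> gapdet X T1 y' w' a' = gapdet X T2 y' w' a' by move=> ->.
have E1 : gapdet X (y.+1 + z.+1 + 2 * a).+2 y z a.+2 = (-1) ^+ (y * z) * gap_product X y z a.+2.
  by rewrite -IH1; [apply: e; lia|lia].
have n0 : gapdet X (y.+1 + z.+1 + 2 * a).+2 y z a.+2 != 0.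
  by rewrite E1 mulf_neq0 ?gap_product_neq0.
have DJ := gapdet_rec n0.
have E2 : gapdet X (y.+1 + z.+1 + 2 * a).+1 y z.+1 a.+1 = (-1) ^+ (y * z.+1) * gap_product X y z.+1 a.+1.
  by rewrite -IH1; [apply: e; lia|lia].
have E3 : gapdet X (y.+1 + z.+1 + 2 * a).+2 y.+1 z a.+1 = (-1) ^+ (y.+1 * z) * gap_product X y.+1 z.+1 a.+1.
  by rewrite -IH2; [apply: e; lia|lia].
have E4 : gapdet X (y.+1 + z.+1 + 2 * a).+1 y.+1 z a.+1 = (-1) ^+ (y.+1 * z) * gap_product X y.+1 z a.+1.
  by rewrite -IH1; [apply: e; lia|lia].
have E5 : gapdet X (y.+1 + z.+1 + 2 * a).+2 y z.+1 a.+1 = (-1) ^+ (y * z.+1) * gap_product X y z.+2 a.+1.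
  by rewrite -IH2; [apply: e; lia|lia].
apply: (mulIf n0); rewrite -mulrA DJ E1 E2 E3 E4 E5.
have PR := gap_product_rec X y z a.
rewrite !mulSn !mulnS !exprD !exprS.
transitivity ((-1) ^+ z * (-1) ^+ y * (-1) ^+ y * (-1) ^+ (y * z) * (-1) ^+ (y * z) *
              (gap_product X y.+1 z.+2 a * gap_product X y z a.+2)); last by ring.
by rewrite PR; ring.
Qed.

(** * Invariant tilings and matchings of the wedge *)

Lemma mem_matchings ds us m : uniq us ->
  (m \in matchings ds us) =
  [&& unzip1 m == ds, perm_eq (unzip2 m) us & all (fun e => e.2 \in neighbours e.1) m].
Proof.
elim: ds us m => [|d ds IH] us m uus.
  case: us uus => [|u us] uus; case: m => [|e m] //=.
  by rewrite in_nil; apply/esym/negbTE/negP => /andP [/perm_size].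
apply/idP/idP.
  case/allpairsPdep => u [m' [hu hm' ->]] /=; move: hu hm'; rewrite mem_filter => /andP [uus' ud].
  rewrite IH ?rem_uniq // => /and3P [/eqP -> pm ->].
  by rewrite eqxx ud andbT /= perm_sym (perm_trans (perm_to_rem uus')) // perm_cons perm_sym.
case: m => [|[d' u] m] //= /and3P [/eqP [-> e1] pm /andP [ud al]].
have uin : u \in us by rewrite -(perm_mem pm) mem_head.
apply/allpairsPdep; exists u, m; split => //.
  by rewrite -[_ \in _]/(u \in [seq v <- neighbours d | v \in us]) mem_filter uin.
rewrite IH ?rem_uniq // e1 eqxx al andbT /= -(perm_cons u).
exact: perm_trans pm (perm_to_rem uin).
Qed.

Lemma matchings_uniq ds us : uniq us -> uniq (matchings ds us).
Proof.
elim: ds us => [|d ds IH] us uus; first by case: us uus.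
apply: allpairs_uniq_dep; first exact/filter_uniq/uniq_neighbours.
- by move=> u _; apply/IH/rem_uniq.
- by move=> [u m] [u' m'] /= _ _ [-> ->].
Qed.

Lemma uniq_map_inj (A B : eqType) (f : A -> B) (s : seq A) :
  uniq (map f s) -> {in s &, injective f}.
Proof.
elim: s => [|a s IH] //= /andP [ha us] b c; rewrite !inE.
move=> /orP [/eqP ->|hb] /orP [/eqP ->|hc] // e.
- by move: ha; rewrite e map_f.
- by move: ha; rewrite -e map_f.
- exact: IH.
Qed.

(** Choice along a list. The graph keeps the order of [s], as an element of [matchings] must. *)
Lemma graph_seq (A B : eqType) (s : seq A) (P : A -> B -> Prop) :
  (forall a, a \in s -> exists b, P a b) ->
  exists m : seq (A * B), unzip1 m = s /\ (forall e, e \in m -> P e.1 e.2).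
Proof.
elim: s => [|a s IH] h; first by exists [::].
have [b Pab] := h a (mem_head _ _).
have [m [m1 m2]] := IH (fun a' ha' => h a' (mem_behead (s := a :: s) ha')).
exists ((a, b) :: m); split; first by rewrite /= m1.
by move=> e; rewrite inE => /orP [/eqP -> //|/m2].
Qed.

Section Wedge.

Variables (y t a x : nat).
Hypothesis hyt : (y < t)%N.

Let L : nat := (6 * t + 2 * x + 6 * a)%N.
Let R := in_H2 t y a x.

Definition hole_free (p : nat * nat) : bool :=
  (p.1 < 2 * t + 2 * a)%N &&
  ~~ ((2 * t + 2 * a + x + y <= p.2)%N && (2 * t - 2 * y <= p.1)%N).

(* A pair [p] stands for the two smaller coordinates of a triangle of the wedge; [wedge_up] and
   [wedge_down] tell for which pairs the triangle of the given orientation lies in the region. *)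
Definition wedge_up (p : nat * nat) : bool :=
  [&& (p.1 < p.2)%N, (p.1 + 2 * p.2 + 1 < L)%N, (2 * t <= p.1 + p.2)%N & hole_free p].

Definition wedge_down (p : nat * nat) : bool :=
  [&& (p.1 < p.2)%N, (p.1 + 2 * p.2 + 2 < L)%N, (2 * t <= (p.1 + p.2).+1)%N & hole_free p].

Definition tri_sum (tr : tri) : int := if tr.2 then L%:Z - 1 else L%:Z - 2.

Definition third (tr : tri) : int := tri_sum tr - tr.1.1 - tr.1.2.

(** In barycentric coordinates a cut corner is where one coordinate reaches [M], the central hole is
    where all reach [c], and a satellite hole is where two reach [q] and the other [w]. Lowering a
    coordinate thus never enters a hole. *)
Definition region (i j k : int) : bool :=
  let M := (4 * t + 2 * x + 6 * a)%:Z in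
  let c := (2 * t + 2 * a)%:Z in
  let q := (2 * t + 2 * a + x + y)%:Z in
  let w := (2 * t - 2 * y)%:Z in
  [&& 0 <= i < M, 0 <= j < M, 0 <= k < M, ~~ [&& c <= i, c <= j & c <= k],
      ~~ [&& q <= i, w <= j & q <= k], ~~ [&& q <= i, q <= j & w <= k] &
      ~~ [&& w <= i, q <= j & q <= k]].

Lemma in_H2E tr : R tr = region tr.1.1 tr.1.2 (third tr).
Proof.
case: tr => [[i j] u]; rewrite /R /in_H2 /in_hexagon /in_central_hole /in_satellite_holes.
rewrite /in_south_hole /in_up_triangle /rot120 /region /third /tri_sum /bigL /L /=.
case: u => /=.
  apply/idP/idP; lia.
apply/idP/idP; lia.
Qed.


Let rot := rot120 t a x.
Let refl := reflV t a x.

Lemma rotE tr : rot tr = (third tr, tr.1.1, tr.2).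
Proof.
by case: tr => [[i j] []]; rewrite /rot /rot120 /third /tri_sum /bigL /L /=; congr (_, _, _); lia.
Qed.

Lemma reflE tr : refl tr = (third tr, tr.1.2, tr.2).
Proof.
by case: tr => [[i j] []]; rewrite /refl /reflV /third /tri_sum /bigL /L /=; congr (_, _, _); lia.
Qed.

Lemma third_rot tr : third (rot tr) = tr.1.2.
Proof. rewrite rotE /third /tri_sum /=; lia. Qed.

Lemma third_refl tr : third (refl tr) = tr.1.1.
Proof. rewrite reflE /third /tri_sum /=; lia. Qed.

Lemma region_rot i j k : region k i j = region i j k.
Proof. rewrite /region; apply/idP/idP; lia. Qed.

Lemma region_refl i j k : region k j i = region i j k.
Proof. rewrite /region; apply/idP/idP; lia. Qed.

Lemma R_rot tr : R (rot tr) = R tr.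
Proof. by rewrite !in_H2E third_rot rotE /= region_rot. Qed.

Lemma R_refl tr : R (refl tr) = R tr.
Proof. by rewrite !in_H2E third_refl reflE /= region_refl. Qed.

(* [p] lists the two smaller of the three distinct barycentric coordinates of [tr]. *)
Definition sorted_coords (tr : tri) (p : nat * nat) : bool :=
  let: (i, j, k) := (tr.1.1, tr.1.2, third tr) in
  let: (b, c) := (p.1%:Z, p.2%:Z) in
  [&& b < c, b + c + c < tri_sum tr &
   [|| (i == b) && (j == c), (i == c) && (j == b), (i == b) && (k == c),
       (i == c) && (k == b), (j == b) && (k == c) | (j == c) && (k == b)]].

Definition on_axis (tr : tri) : bool :=
  [|| tr.1.1 == tr.1.2, tr.1.2 == third tr | tr.1.1 == third tr].

Definition axis_loz (l : loz) : bool :=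
  [|| (l.1.1.1 == l.1.1.2) && (l.2.1.1 == l.2.1.2),
      (l.1.1.2 == third l.1) && (l.2.1.2 == third l.2) |
      (l.1.1.1 == third l.1) && (l.2.1.1 == third l.2)].

Lemma sorted_coords_rot tr p : sorted_coords (rot tr) p = sorted_coords tr p.
Proof.
rewrite /sorted_coords third_rot rotE /tri_sum /=; congr [&& _, _ & _].
by do 6 case: (_ == _ :> int).
Qed.

Lemma sorted_coords_refl tr p : sorted_coords (refl tr) p = sorted_coords tr p.
Proof.
rewrite /sorted_coords third_refl reflE /tri_sum /=; congr [&& _, _ & _].
by do 6 case: (_ == _ :> int).
Qed.

Lemma sorted_coords_inj tr p p' : sorted_coords tr p -> sorted_coords tr p' -> p = p'.
Proof.
case: tr p p' => [[i j] u] [b c] [b' c']; rewrite /sorted_coords /third /=.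
by move=> h h'; congr pair; lia.
Qed.

Lemma sorted_coords_cases tr p : sorted_coords tr p ->
  [\/ tr.1.1 = p.1 /\ tr.1.2 = p.2, tr.1.1 = p.2 /\ tr.1.2 = p.1 |
   [\/ tr.1.1 = p.1 /\ third tr = p.2, tr.1.1 = p.2 /\ third tr = p.1,
       tr.1.2 = p.1 /\ third tr = p.2 | tr.1.2 = p.2 /\ third tr = p.1]].
Proof.
move=> /and3P [_ _]; case/or4P => [||/andP [/eqP -> /eqP ->]|].
- by case/andP => /eqP -> /eqP ->; constructor 1.
- by case/andP => /eqP -> /eqP ->; constructor 2.
- by constructor 3; constructor 1.
case/or3P => /andP [/eqP -> /eqP ->]; constructor 3.
- by constructor 2.
- by constructor 3.
- by constructor 4.
Qed.

Lemma sorted_coordsI tr (p : nat * nat) :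
  (p.1 < p.2)%N -> p.1%:Z + p.2%:Z + p.2%:Z < tri_sum tr ->
  [\/ tr.1.1 = p.1 /\ tr.1.2 = p.2, tr.1.1 = p.2 /\ tr.1.2 = p.1 |
   [\/ tr.1.1 = p.1 /\ third tr = p.2, tr.1.1 = p.2 /\ third tr = p.1,
       tr.1.2 = p.1 /\ third tr = p.2 | tr.1.2 = p.2 /\ third tr = p.1]] ->
  sorted_coords tr p.
Proof.
move=> h1 h2 h; apply/and3P; split=> //.
by case: h => [[-> ->]|[-> ->]|[[-> ->]|[-> ->]|[-> ->]|[-> ->]]]; rewrite !eqxx ?orbT.
Qed.

(** The sum of squares serves as an orbit invariant. Changing either of two coordinates of a
    triangle by the same unit gives equal sums only if these coordinates are equal, which is how
    uniqueness of neighbours off the axes is proved. *)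
Lemma sorted_coords_squares tr p : sorted_coords tr p ->
  let r := tri_sum tr - p.1%:Z - p.2%:Z in
  tr.1.1 * tr.1.1 + tr.1.2 * tr.1.2 + third tr * third tr =
  p.1%:Z * p.1%:Z + p.2%:Z * p.2%:Z + r * r.
Proof.
move=> /sorted_coords_cases h /=.
have e : tri_sum tr - p.1%:Z - p.2%:Z = tr.1.1 + tr.1.2 + third tr - p.1%:Z - p.2%:Z.
  by rewrite /third; ring.
by rewrite e; case: h => [[-> ->]|[-> ->]|[[-> ->]|[-> ->]|[-> ->]|[-> ->]]]; ring.
Qed.

Lemma region_sorted tr p : sorted_coords tr p ->
  region tr.1.1 tr.1.2 (third tr) = region (tri_sum tr - p.1%:Z - p.2%:Z) p.1 p.2.
Proof.
move=> /sorted_coords_cases; case: tr p => [[i j] u] [b c]; rewrite /third /=.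
set s := tri_sum _; clearbody s.
case=> [[-> ->]|[-> ->]|[[-> h]|[-> h]|[-> h]|[-> h]]].
- by rewrite -region_rot; congr region; lia.
- by rewrite -region_refl; congr region; lia.
- by rewrite region_refl region_rot; congr region; lia.
- by rewrite region_rot; congr region; lia.
- by congr region; lia.
- by rewrite region_rot region_refl; congr region; lia.
Qed.

Lemma R_up tr p : sorted_coords tr p -> tr.2 -> R tr = wedge_up p.
Proof.
move=> h u; rewrite in_H2E (region_sorted h) /tri_sum u.
move/and3P: h; rewrite /tri_sum u; case: p => b c /= [h1 h2 _].
rewrite /region /wedge_up /hole_free /= /L in h2 *; apply/idP/idP; lia.
Qed.

Lemma R_down tr p : sorted_coords tr p -> ~~ tr.2 -> R tr = wedge_down p.
Proof.
move=> h u; rewrite in_H2E (region_sorted h) /tri_sum (negbTE u).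
move/and3P: h; rewrite /tri_sum (negbTE u); case: p => b c /= [h1 h2 _].
rewrite /region /wedge_down /hole_free /= /L in h2 *; apply/idP/idP; lia.
Qed.

Lemma sorted_coords_ex tr : R tr -> ~~ on_axis tr -> exists p, sorted_coords tr p.
Proof.
rewrite in_H2E => /and4P [hi hj hk _]; rewrite /on_axis /sorted_coords.
have := erefl (third tr); rewrite {2}/third; move: hi hj hk.
case: tr => [[i j] u] /=; move: (tri_sum _) (third _) => s k hi hj hk e na.
have [m [M [h1 [h2 h3]]]] : exists m M : int, (0 <= m < M) /\ ((M < s - m - M) /\
  (((i == m) && (j == M)) || (((i == M) && (j == m)) || (((i == m) && (k == M)) ||
   (((i == M) && (k == m)) || (((j == m) && (k == M)) || ((j == M) && (k == m)))))))).
  have : (i < j < k) \/ (j < i < k) \/ (i < k < j) \/ (k < i < j) \/ (j < k < i) \/ (k < j < i).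
    by lia.
  case=> [h|[h|[h|[h|[h|h]]]]].
  - by exists i, j; rewrite !eqxx; split=> //; lia.
  - by exists j, i; rewrite !eqxx !orbT; split=> //; lia.
  - by exists i, k; rewrite !eqxx !orbT; split=> //; lia.
  - by exists k, i; rewrite !eqxx !orbT; split=> //; lia.
  - by exists j, k; rewrite !eqxx !orbT; split=> //; lia.
  - by exists k, j; rewrite !eqxx !orbT; split=> //; lia.
have [m0 M0] : 0 <= m /\ 0 <= M by lia.
exists (`|m|%N, `|M|%N) => /=; rewrite !gez0_abs //; apply/and3P; split=> //; lia.
Qed.

Ltac place := apply: sorted_coordsI; rewrite /third /tri_sum /=; [lia | lia |
  first [by constructor 1; split; lia | by constructor 2; split; lia
       | by constructor 3; constructor 1; split; lia | by constructor 3; constructor 2; split; lia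
       | by constructor 3; constructor 3; split; lia | by constructor 3; constructor 4; split; lia]].

Lemma neighboursP (p q : nat * nat) : p \in neighbours q ->
  p = q \/ p = (q.1.+1, q.2) \/ p = (q.1, q.2.+1).
Proof. by rewrite !inE => /or3P [] /eqP ->; [left|right; left|right; right]. Qed.

Lemma adjacent_down (tr : tri) (p q : nat * nat) : sorted_coords tr p -> tr.2 ->
  p \in neighbours q -> (q.1 < q.2)%N -> (q.1 + 2 * q.2 + 2 < L)%N ->
  exists d : tri, [/\ is_lozenge (tr, d), ~~ d.2 & sorted_coords d q].
Proof.
case: tr p q => [[i j] []] //= [b c] [b' c'] h _ /neighboursP /= hn h1 h2.
move: (sorted_coords_cases h); rewrite /third /tri_sum /= => hc.
suff : [|| sorted_coords (i, j, false) (b', c'), sorted_coords (i - 1, j, false) (b', c')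
         | sorted_coords (i, j - 1, false) (b', c')].
  case/or3P => h'; [exists (i, j, false)|exists (i - 1, j, false)|exists (i, j - 1, false)];
  by split=> //; rewrite /is_lozenge /= !eqxx ?orbT.
apply/or3P; case: hn => [[e1 e2]|[[e1 e2]|[e1 e2]]];
  case: hc => [[? e]|[? e]|[[? e]|[? e]|[? e]|[? e]]];
  (first [constructor 1; place | constructor 2; place | constructor 3; place]).
Qed.

Lemma adjacent_up (tr : tri) (p q : nat * nat) : sorted_coords tr q -> ~~ tr.2 ->
  p \in neighbours q -> (p.1 < p.2)%N -> (p.1 + 2 * p.2 + 1 < L)%N ->
  exists u : tri, [/\ is_lozenge (u, tr), u.2 & sorted_coords u p].
Proof.
case: tr p q => [[i j] []] //= [b c] [b' c'] h _ /neighboursP /= hn h1 h2.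
move: (sorted_coords_cases h); rewrite /third /tri_sum /= => hc.
suff : [|| sorted_coords (i, j, true) (b, c), sorted_coords (i + 1, j, true) (b, c)
         | sorted_coords (i, j + 1, true) (b, c)].
  case/or3P => h'; [exists (i, j, true)|exists (i + 1, j, true)|exists (i, j + 1, true)];
  by split=> //; rewrite /is_lozenge /= ?addrK !eqxx ?orbT.
apply/or3P; case: hn => [[e1 e2]|[[e1 e2]|[e1 e2]]];
  case: hc => [[? e]|[? e]|[[? e]|[? e]|[? e]|[? e]]];
  (first [constructor 1; place | constructor 2; place | constructor 3; place]).
Qed.

Lemma is_lozengeP (u d : tri) : is_lozenge (u, d) ->
  u.2 /\ d.2 = false /\ (d.1 = u.1 \/ d.1 = (u.1.1 - 1, u.1.2) \/ d.1 = (u.1.1, u.1.2 - 1)).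
Proof.
case: u d => [[i j] u] [[i' j'] d] /= /and3P [-> /negbTE ->] h; do 2 split=> //.
by case/orP: h => [/orP [/eqP ->|/eqP ->]|/eqP ->]; [left|right; left|right; right].
Qed.

Lemma sorted_coords_off_axis tr p : sorted_coords tr p -> ~~ on_axis tr.
Proof.
move=> h; move: (h) => /and3P [h1 h2 _]; move: h2; rewrite /on_axis /third.
by case: (sorted_coords_cases h) => [[]|[]|[[]|[]|[]|[]]]; rewrite /third => *; lia.
Qed.

Lemma adjacent_down_uniq (u d d' : tri) q : is_lozenge (u, d) -> is_lozenge (u, d') ->
  ~~ on_axis u -> sorted_coords d q -> sorted_coords d' q -> d = d'.
Proof.
move=> /is_lozengeP [uT [dF hd]] /is_lozengeP [_ [dF' hd']].
case: u d d' q uT dF dF' hd hd' => [[i j] u] [[i1 j1] d] [[i2 j2] d'] [b c] /= -> -> ->.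
rewrite /on_axis => hd hd' hu /sorted_coords_squares /= h1 /sorted_coords_squares /=.
rewrite -h1; move: hu; rewrite /third /tri_sum /= => {h1}.
by case: hd => [[-> ->]|[[-> ->]|[-> ->]]]; case: hd' => [[-> ->]|[[-> ->]|[-> ->]]] //;
  move=> h1 h2; exfalso; lia.
Qed.

Lemma adjacent_up_uniq (u u' d : tri) p : is_lozenge (u, d) -> is_lozenge (u', d) ->
  ~~ on_axis d -> sorted_coords u p -> sorted_coords u' p -> u = u'.
Proof.
move=> /is_lozengeP [uT [dF hd]] /is_lozengeP [uT' [_ hd']].
case: u u' d p uT uT' dF hd hd' => [[i1 j1] u] [[i2 j2] u'] [[i j] d] [b c] /= -> -> ->.
have cs (i' j' : int) : (i, j) = (i', j') \/ (i, j) = (i' - 1, j') \/ (i, j) = (i', j' - 1) ->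
  (i', j') = (i, j) \/ (i', j') = (i + 1, j) \/ (i', j') = (i, j + 1).
  by case=> [[-> ->]|[[-> ->]|[-> ->]]]; rewrite ?subrK; [left|right; left|right; right].
rewrite /on_axis => /cs hd /cs hd' hu /sorted_coords_squares /= h1 /sorted_coords_squares /=.
rewrite -h1; move: hu; rewrite /third /tri_sum /= => {h1 cs}.
by case: hd => [[-> ->]|[[-> ->]|[-> ->]]]; case: hd' => [[-> ->]|[[-> ->]|[-> ->]]] //;
  move=> h1 h2; exfalso; lia.
Qed.

Lemma axis_loz_on_axis l : axis_loz l -> on_axis l.1 /\ on_axis l.2.
Proof. by rewrite /axis_loz /on_axis => /or3P [] /andP [-> ->]; rewrite ?orbT. Qed.

(** Two coordinates of [u] are equal and [L] is even, so the remaining one is odd, hence positive.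
    Lowering it stays in the region. *)
Lemma axis_down_ex u : R u -> u.2 -> on_axis u ->
  exists d, [/\ is_lozenge (u, d), R d & axis_loz (u, d)].
Proof.
case: u => [[i j] []] //; rewrite in_H2E /on_axis /axis_loz /third /tri_sum /= => r _ /or3P [] h.
- exists (i, j, false); split; rewrite /= ?eqxx ?h //.
  by rewrite in_H2E; move: r h; rewrite /region /third /tri_sum /= /L; lia.
- exists (i - 1, j, false); rewrite in_H2E /third /tri_sum /= ?eqxx ?orbT; split=> //.
    by move: r h; rewrite /region /third /tri_sum /= /L; lia.
  lia.
- exists (i, j - 1, false); rewrite in_H2E /third /tri_sum /= ?eqxx ?orbT; split=> //.
    by move: r h; rewrite /region /third /tri_sum /= /L; lia.
  lia.
Qed.

(** Here the remaining coordinate is even, so raising it by one cannot reach [M], [c] or [w]. These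
    bounds are all even and, on an axis, the only ones that restrict it from above. *)
Lemma axis_up_ex d : R d -> ~~ d.2 -> on_axis d ->
  exists u, [/\ is_lozenge (u, d), R u & axis_loz (u, d)].
Proof.
case: d => [[i j] []] //; rewrite in_H2E /on_axis /axis_loz /third /tri_sum /= => r _ /or3P [] h.
- exists (i, j, true); split; rewrite /= ?eqxx ?h //.
  by rewrite in_H2E; move: r h; rewrite /region /third /tri_sum /= /L; lia.
- exists (i + 1, j, true); rewrite in_H2E /third /tri_sum /= ?addrK ?eqxx ?orbT; split=> //.
    by move: r h; rewrite /region /third /tri_sum /= /L; lia.
  lia.
- exists (i, j + 1, true); rewrite in_H2E /third /tri_sum /= ?addrK ?eqxx ?orbT; split=> //.
    by move: r h; rewrite /region /third /tri_sum /= /L; lia.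
  lia.
Qed.

(** Two different partners would put [u] on all three axes, but no triangle of the region has three
    equal coordinates. *)
Lemma axis_down_uniq (u d d' : tri) : R u -> is_lozenge (u, d) -> is_lozenge (u, d') ->
  axis_loz (u, d) -> axis_loz (u, d') -> d = d'.
Proof.
rewrite in_H2E => r /is_lozengeP [uT [dF hd]] /is_lozengeP [_ [dF' hd']].
case: u d d' uT dF dF' hd hd' r => [[i j] u] [[i1 j1] d] [[i2 j2] d'] /= -> -> ->.
rewrite /axis_loz /region /third /tri_sum /= /L => hd hd' r.
by case: hd => [[-> ->]|[[-> ->]|[-> ->]]]; case: hd' => [[-> ->]|[[-> ->]|[-> ->]]] //;
  move=> h1 h2; exfalso; lia.
Qed.

Lemma axis_up_uniq (u u' d : tri) : R d -> is_lozenge (u, d) -> is_lozenge (u', d) ->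
  axis_loz (u, d) -> axis_loz (u', d) -> u = u'.
Proof.
rewrite in_H2E => r /is_lozengeP [uT [dF hd]] /is_lozengeP [uT' [_ hd']].
case: u u' d uT uT' dF hd hd' r => [[i1 j1] u] [[i2 j2] u'] [[i j] d] /= -> -> ->.
have cs (i' j' : int) : (i, j) = (i', j') \/ (i, j) = (i' - 1, j') \/ (i, j) = (i', j' - 1) ->
  (i', j') = (i, j) \/ (i', j') = (i + 1, j) \/ (i', j') = (i, j + 1).
  by case=> [[-> ->]|[[-> ->]|[-> ->]]]; rewrite ?subrK; [left|right; left|right; right].
rewrite /axis_loz /region /third /tri_sum /= /L => /cs hd /cs hd' r.
by case: hd => [[-> ->]|[[-> ->]|[-> ->]]]; case: hd' => [[-> ->]|[[-> ->]|[-> ->]]] //;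
  move=> h1 h2; exfalso; lia.
Qed.

(** The representative of the orbit of [p] whose first coordinate is the largest. *)
Definition up_tri (p : nat * nat) : tri := (L%:Z - 1 - p.1%:Z - p.2%:Z, p.1%:Z, true).
Definition down_tri (p : nat * nat) : tri := (L%:Z - 2 - p.1%:Z - p.2%:Z, p.1%:Z, false).

Lemma third_up_tri p : third (up_tri p) = p.2.
Proof. rewrite /third /tri_sum /up_tri /=; lia. Qed.

Lemma third_down_tri p : third (down_tri p) = p.2.
Proof. rewrite /third /tri_sum /down_tri /=; lia. Qed.

Lemma sorted_up_tri p : wedge_up p -> sorted_coords (up_tri p) p.
Proof.
case/and3P => h1 h2 _; rewrite /sorted_coords third_up_tri /tri_sum /= !eqxx !orbT; lia.
Qed.

Lemma sorted_down_tri p : wedge_down p -> sorted_coords (down_tri p) p.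
Proof.
case/and3P => h1 h2 _; rewrite /sorted_coords third_down_tri /tri_sum /= !eqxx !orbT; lia.
Qed.

Definition points : seq (nat * nat) := [seq (i, j) | i <- iota 0 L, j <- iota 0 L].
Definition downs : seq (nat * nat) :=
  sort (fun p q => level p <= level q)%N [seq p <- points | wedge_down p].
Definition ups : seq (nat * nat) := [seq p <- points | wedge_up p].

Lemma mem_points p : (p \in points) = (p.1 < L)%N && (p.2 < L)%N.
Proof.
case: p => i j; apply/allpairsP/idP => /= [[[i' j'] /= [h1 h2 [-> ->]]]|h].
  by move: h1 h2; rewrite !mem_iota !add0n /= => -> ->.
by exists (i, j); rewrite /= !mem_iota; split=> //; lia.
Qed.

Lemma points_uniq : uniq points.
Proof. by apply: allpairs_uniq; rewrite ?iota_uniq // => -[? ?] [? ?] _ _ [-> ->]. Qed.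

Lemma mem_downs p : (p \in downs) = wedge_down p.
Proof.
case: p => b c; rewrite mem_sort mem_filter mem_points andb_idr // => /and3P [/= h1 h2 _]; lia.
Qed.

Lemma mem_ups p : (p \in ups) = wedge_up p.
Proof.
case: p => b c; rewrite mem_filter mem_points andb_idr // => /and3P [/= h1 h2 _]; lia.
Qed.

Lemma downs_uniq : uniq downs.
Proof. by rewrite sort_uniq filter_uniq // points_uniq. Qed.

Lemma ups_uniq : uniq ups.
Proof. by rewrite filter_uniq // points_uniq. Qed.

Definition tris : seq tri :=
  [seq ((ij.1%:Z, ij.2%:Z), b) | ij <- points, b <- [:: true; false]].

Lemma mem_tris tr : R tr -> tr \in tris.
Proof.
rewrite in_H2E; case: tr => [[i j] u]; rewrite /third /tri_sum /region /= => h.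
apply/allpairsP; exists ((`|i|%N, `|j|%N), u); rewrite /= mem_points /=; split.
- by move: h; rewrite /L; case: (u); lia.
- by case: (u).
- by rewrite !gez0_abs //; lia.
Qed.

(** Off the axes a pair of [m] stands for a whole orbit of lozenges; the lozenges on the axes are
    the same for all [m]. Filtering a list of pairs only serves to obtain a finite set. *)
Definition tile (m : seq ((nat * nat) * (nat * nat))) : {fset loz} :=
  [fset l in [seq l <- [seq (u, d) | u <- tris, d <- tris] |
     [&& is_lozenge l, R l.1, R l.2 &
         axis_loz l || has (fun e => sorted_coords l.2 e.1 && sorted_coords l.1 e.2) m]]]%fset.

Lemma mem_tile m l : (l \in tile m) = [&& is_lozenge l, R l.1, R l.2 &
  axis_loz l || has (fun e => sorted_coords l.2 e.1 && sorted_coords l.1 e.2) m].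
Proof.
rewrite /tile !inE /= mem_filter; apply: andb_idr => /and4P [_ h1 h2 _].
by case: l h1 h2 => u d h1 h2; apply/allpairsP; exists (u, d); rewrite /= !mem_tris.
Qed.

Lemma is_lozenge_rot l : is_lozenge l -> is_lozenge (map_loz rot l).
Proof.
case: l => u d /is_lozengeP [uT [dF h]]; rewrite /map_loz /= !rotE.
case: u d uT dF h => [[i j] u] [[i' j'] d] /= -> -> h.
by case: h => [[-> ->]|[[-> ->]|[-> ->]]]; rewrite /third /tri_sum /= !xpair_eqE; lia.
Qed.

Lemma is_lozenge_refl l : is_lozenge l -> is_lozenge (map_loz refl l).
Proof.
case: l => u d /is_lozengeP [uT [dF h]]; rewrite /map_loz /= !reflE.
case: u d uT dF h => [[i j] u] [[i' j'] d] /= -> -> h.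
by case: h => [[-> ->]|[[-> ->]|[-> ->]]]; rewrite /third /tri_sum /= !xpair_eqE; lia.
Qed.

Lemma axis_loz_rot l : axis_loz (map_loz rot l) = axis_loz l.
Proof.
rewrite /axis_loz /map_loz /= !third_rot !rotE /=.
rewrite [third l.1 == l.1.1.1]eq_sym [third l.2 == l.2.1.1]eq_sym.
rewrite [third l.1 == l.1.1.2]eq_sym [third l.2 == l.2.1.2]eq_sym.
by do 6 case: (_ == _ :> int).
Qed.

Lemma axis_loz_refl l : axis_loz (map_loz refl l) = axis_loz l.
Proof.
rewrite /axis_loz /map_loz /= !third_refl !reflE /=.
rewrite [third l.1 == l.1.1.2]eq_sym [third l.2 == l.2.1.2]eq_sym.
rewrite [l.1.1.2 == l.1.1.1]eq_sym [l.2.1.2 == l.2.1.1]eq_sym.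
rewrite [third l.1 == l.1.1.1]eq_sym [third l.2 == l.2.1.1]eq_sym.
by do 6 case: (_ == _ :> int).
Qed.

Lemma rot3 tr : rot (rot (rot tr)) = tr.
Proof. by rewrite rotE third_rot [rot (rot tr)]rotE third_rot rotE /=; case: tr => [[]]. Qed.

Lemma refl2 tr : refl (refl tr) = tr.
Proof. by rewrite reflE third_refl reflE /=; case: tr => [[]]. Qed.

Lemma rot_refl tr : rot (refl tr) = (tr.1.1, third tr, tr.2).
Proof. by rewrite rotE third_refl reflE. Qed.

Lemma rot2_refl tr : rot (rot (refl tr)) = (tr.1.2, tr.1.1, tr.2).
Proof. by rewrite rotE third_rot rot_refl reflE. Qed.

(** As [f] has finite order [k] on lozenges, its iterate [k.-1] supplies preimages. *)
Lemma imfset_closed (f : tri -> tri) (T : {fset loz}) (k : nat) :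
  (forall l, l \in T -> map_loz f l \in T) ->
  (0 < k)%N -> (forall l, iter k (map_loz f) l = l) ->
  [fset map_loz f l | l in T]%fset = T.
Proof.
move=> hf; case: k => // k _ hk; apply/fsetP => l; apply/imfsetP/idP => /= [[l' h ->]|h].
  exact: hf.
exists (iter k (map_loz f) l); last by rewrite -iterS hk.
by elim: k {hk} => //= k; exact: hf.
Qed.

(** * From a matching to an invariant tiling *)

Section Matching.

Variable m : seq ((nat * nat) * (nat * nat)).
Hypothesis hm : m \in matchings downs ups.

Let hm3 : [&& unzip1 m == downs, perm_eq (unzip2 m) ups & all (fun e => e.2 \in neighbours e.1) m].
Proof. by rewrite -mem_matchings ?ups_uniq. Qed.

Lemma matching_down e : e \in m -> wedge_down e.1.
Proof.
by move=> h; case/and3P: hm3 => /eqP h1 _ _; rewrite -mem_downs -h1; apply/mapP; exists e.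
Qed.

Lemma matching_up e : e \in m -> wedge_up e.2.
Proof.
move=> h; case/and3P: hm3 => _ h1 _; rewrite -mem_ups -(perm_mem h1).
by apply/mapP; exists e.
Qed.

Lemma matching_adj e : e \in m -> e.2 \in neighbours e.1.
Proof. by case/and3P: hm3 => _ _ /allP; apply. Qed.

Lemma matching_down_ex p : wedge_down p -> exists2 e, e \in m & e.1 = p.
Proof.
by rewrite -mem_downs; case/and3P: hm3 => /eqP <- _ _ /mapP [e h ->]; exists e.
Qed.

Lemma matching_up_ex p : wedge_up p -> exists2 e, e \in m & e.2 = p.
Proof.
by rewrite -mem_ups; case/and3P: hm3 => _ /perm_mem <- _ /mapP [e h ->]; exists e.
Qed.

Lemma matching_inj1 e e' : e \in m -> e' \in m -> e.1 = e'.1 -> e = e'.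
Proof.
have u : uniq (unzip1 m) by case/and3P: hm3 => /eqP -> _ _; exact: downs_uniq.
exact: uniq_map_inj.
Qed.

Lemma matching_inj2 e e' : e \in m -> e' \in m -> e.2 = e'.2 -> e = e'.
Proof.
have u : uniq (unzip2 m).
  by case/and3P: hm3 => _ /perm_uniq -> _; exact: ups_uniq.
exact: uniq_map_inj.
Qed.

Lemma covers_up (l : loz) (tr : tri) : is_lozenge l -> tr.2 -> covers l tr -> l.1 = tr.
Proof.
case: l => u d /is_lozengeP [_ [dF _]] trT; rewrite /covers => /orP [/eqP //|/eqP E].
by move: trT; rewrite -E dF.
Qed.

Lemma covers_down (l : loz) (tr : tri) : is_lozenge l -> ~~ tr.2 -> covers l tr -> l.2 = tr.
Proof.
case: l => u d /is_lozengeP [uT _] trF; rewrite /covers => /orP [/eqP E|/eqP //].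
by move: trF; rewrite -E uT.
Qed.

Lemma tile_axis l : l \in tile m -> on_axis l.1 || on_axis l.2 -> axis_loz l.
Proof.
rewrite mem_tile => /and4P [_ _ _ /orP [//|/hasP [e _ /andP [h1 h2]]]].
by rewrite (negbTE (sorted_coords_off_axis h1)) (negbTE (sorted_coords_off_axis h2)).
Qed.

Lemma tile_off_axis l : l \in tile m -> ~~ on_axis l.1 || ~~ on_axis l.2 ->
  exists2 e, e \in m & sorted_coords l.2 e.1 && sorted_coords l.1 e.2.
Proof.
rewrite mem_tile => /and4P [_ _ _ /orP [/axis_loz_on_axis [-> ->] //|/hasP [e h1 h2]] _].
by exists e.
Qed.

Lemma tile_tiling : is_tiling R (tile m).
Proof.
split=> [l|tr Rtr]; first by rewrite mem_tile => /and4P [-> -> ->].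
have lozT l : l \in tile m -> is_lozenge l by rewrite mem_tile => /andP [].
split.
  case: (boolP (on_axis tr)) => ax; case: (boolP tr.2) => trT.
  - have [d [h1 h2 h3]] := axis_down_ex Rtr trT ax.
    by exists (tr, d); rewrite ?/covers ?eqxx // mem_tile h1 /= h2 h3 andbT.
  - have [u [h1 h2 h3]] := axis_up_ex Rtr trT ax.
    by exists (u, tr); rewrite ?/covers ?eqxx ?orbT // mem_tile h1 /= h2 h3 /= andbT.
  - have [p hp] := sorted_coords_ex Rtr ax.
    have [e em ep] : exists2 e, e \in m & e.2 = p by apply: matching_up_ex; rewrite -(R_up hp).
    have wd := matching_down em; case/and3P: (wd) => h1 h2 _.
    have adj := matching_adj em; rewrite ep in adj.
    have [d [l1 l2 l3]] := adjacent_down hp trT adj h1 h2.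
    exists (tr, d); rewrite ?/covers ?eqxx // mem_tile l1 /= (R_down l3 l2) wd Rtr /=.
    by apply/orP; right; apply/hasP; exists e; rewrite // l3 ep hp.
  - have [p hp] := sorted_coords_ex Rtr ax.
    have [e em ep] : exists2 e, e \in m & e.1 = p by apply: matching_down_ex; rewrite -(R_down hp).
    have wu := matching_up em; case/and3P: (wu) => h1 h2 _.
    have adj := matching_adj em; rewrite ep in adj.
    have [u [l1 l2 l3]] := adjacent_up hp trT adj h1 h2.
    exists (u, tr); rewrite ?/covers ?eqxx ?orbT // mem_tile l1 /= (R_up l3 l2) wu Rtr /=.
    by apply/orP; right; apply/hasP; exists e; rewrite // l3 ep hp.
move=> [u1 d1] [u2 d2] h1 h2; case: (boolP tr.2) => trT.
  move=> /(covers_up (lozT _ h1) trT) /= e1 /(covers_up (lozT _ h2) trT) /= e2; subst u1 u2.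
  congr pair; case: (boolP (on_axis tr)) => ax.
    apply: (axis_down_uniq Rtr (lozT _ h1) (lozT _ h2)); apply: tile_axis => //=; by rewrite ax.
  have [e1 m1 /andP [/= s1 s1']] : exists2 e, e \in m & sorted_coords d1 e.1 && sorted_coords tr e.2.
    by apply: (tile_off_axis h1); rewrite /= ax.
  have [e2 m2 /andP [/= s2 s2']] : exists2 e, e \in m & sorted_coords d2 e.1 && sorted_coords tr e.2.
    by apply: (tile_off_axis h2); rewrite /= ax.
  have E := matching_inj2 m1 m2 (sorted_coords_inj s1' s2'); subst e2.
  exact: (adjacent_down_uniq (lozT _ h1) (lozT _ h2) ax s1 s2).
move=> /(covers_down (lozT _ h1) trT) /= e1 /(covers_down (lozT _ h2) trT) /= e2; subst d1 d2.
congr pair; case: (boolP (on_axis tr)) => ax.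
  apply: (axis_up_uniq Rtr (lozT _ h1) (lozT _ h2)); apply: tile_axis => //=; by rewrite ax orbT.
have [e1 m1 /andP [/= s1 s1']] : exists2 e, e \in m & sorted_coords tr e.1 && sorted_coords u1 e.2.
  by apply: (tile_off_axis h1); rewrite /= ax orbT.
have [e2 m2 /andP [/= s2 s2']] : exists2 e, e \in m & sorted_coords tr e.1 && sorted_coords u2 e.2.
  by apply: (tile_off_axis h2); rewrite /= ax orbT.
have E := matching_inj1 m1 m2 (sorted_coords_inj s1 s2); subst e2.
exact: (adjacent_up_uniq (lozT _ h1) (lozT _ h2) ax s1' s2').
Qed.

Lemma tile_rot l : l \in tile m -> map_loz rot l \in tile m.
Proof.
rewrite !mem_tile => /and4P [h1 h2 h3 h4]; rewrite is_lozenge_rot //= !R_rot h2 h3 /=.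
by rewrite axis_loz_rot //; under eq_has do rewrite !sorted_coords_rot.
Qed.

Lemma tile_refl l : l \in tile m -> map_loz refl l \in tile m.
Proof.
rewrite !mem_tile => /and4P [h1 h2 h3 h4]; rewrite is_lozenge_refl //= !R_refl h2 h3 /=.
by rewrite axis_loz_refl //; under eq_has do rewrite !sorted_coords_refl.
Qed.

Lemma tile_CSTC : is_CSTC_tiling t y a x (tile m).
Proof.
split; first exact: tile_tiling.
- by apply: (@imfset_closed _ _ 3 tile_rot) => // -[u d]; rewrite /map_loz /= !rot3.
- by apply: (@imfset_closed _ _ 2 tile_refl) => // -[u d]; rewrite /map_loz /= !refl2.
Qed.

End Matching.

(** The lozenge at [down_tri d] reveals the partner of [d], so every pair of [m] is a pair of [m'].
    Both lists have the first components [downs] in the same order, hence they are equal. *)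
Lemma tile_inj m m' : m \in matchings downs ups -> m' \in matchings downs ups ->
  tile m = tile m' -> m = m'.
Proof.
move=> hm hm' E.
have lozT l : l \in tile m -> is_lozenge l by rewrite mem_tile => /andP [].
have sub e : e \in m -> e \in m'.
  move=> em; have wd := matching_down hm em; have wu := matching_up hm em.
  have sd := sorted_down_tri wd; have Rd : R (down_tri e.1) by rewrite (R_down sd).
  case/and3P: (wu) => h1 h2 _.
  have [u [l1 l2 l3]] := adjacent_up sd isT (matching_adj hm em) h1 h2.
  have : (u, down_tri e.1) \in tile m.
    rewrite mem_tile l1 /= (R_up l3 l2) wu Rd /=; apply/orP; right; apply/hasP.
    by exists e; rewrite // sd l3.
  rewrite E => /tile_off_axis [|e' em' /andP [/= s1 s2]].
    by rewrite /= (sorted_coords_off_axis sd) orbT.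
  have e1 := sorted_coords_inj sd s1; have e2 := sorted_coords_inj l3 s2.
  by rewrite (surjective_pairing e) e1 e2 -surjective_pairing.
have e1 : unzip1 m = unzip1 m'.
  move: hm hm'; rewrite !mem_matchings ?ups_uniq //.
  by case/and3P => /eqP -> _ _ /and3P [/eqP -> _ _].
have sz : size m = size m' by rewrite -(size_map fst m) -(size_map fst m') -/(unzip1 m) e1.
have x0 : (nat * nat) * (nat * nat) := ((0, 0), (0, 0))%N.
apply: (@eq_from_nth _ x0) => // i hi.
apply: (matching_inj1 hm'); first exact/sub/mem_nth.
  by apply: mem_nth; rewrite -sz.
by rewrite -!(nth_map _ x0.1) -?sz // -/(unzip1 m) -/(unzip1 m') e1.
Qed.

(** * From an invariant tiling to a matching *)

Section Tiling.

Variable T : {fset loz}.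
Hypothesis hT : is_CSTC_tiling t y a x T.

Lemma tiling_loz l : l \in T -> is_lozenge l.
Proof. by case: hT => -[h _] _ _ /h /and3P []. Qed.

Lemma tiling_R1 l : l \in T -> R l.1.
Proof. by case: hT => -[h _] _ _ /h /and3P []. Qed.

Lemma tiling_R2 l : l \in T -> R l.2.
Proof. by case: hT => -[h _] _ _ /h /and3P []. Qed.

Lemma tiling_ex tr : R tr -> exists2 l, l \in T & covers l tr.
Proof. by case: hT => -[_ h] _ _ /h []. Qed.

Lemma tiling_uniq tr l l' : R tr -> l \in T -> l' \in T -> covers l tr -> covers l' tr -> l = l'.
Proof. by case: hT => -[_ h] _ _ /h [_]; apply. Qed.

Lemma tiling_rot l : l \in T -> map_loz rot l \in T.
Proof. by case: hT => _ h _ lT; rewrite -[T in _ \in T]h; apply: in_imfset. Qed.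

Lemma tiling_refl l : l \in T -> map_loz refl l \in T.
Proof. by case: hT => _ _ h lT; rewrite -[T in _ \in T]h; apply: in_imfset. Qed.

(* A triangle on an axis is fixed by a reflection, hence so is the lozenge covering it. *)
Lemma tiling_axis l : l \in T -> on_axis l.1 || on_axis l.2 -> axis_loz l.
Proof.
move=> lT.
have fixed f tr : (forall l, l \in T -> map_loz f l \in T) -> R tr -> covers l tr ->
    f tr = tr -> f l.1 = l.1 /\ f l.2 = l.2.
  move=> hf Rtr cov ftr.
  have cov' : covers (map_loz f l) tr.
    by move: cov; rewrite /covers /= => /orP [/eqP ->|/eqP ->]; rewrite ftr eqxx ?orbT.
  have := tiling_uniq Rtr (hf l lT) lT cov' cov.
  by case: (l) => u d [-> ->].
have fr l' : l' \in T -> map_loz (fun tr => rot (refl tr)) l' \in T.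
  by move=> /tiling_refl /tiling_rot.
have frr l' : l' \in T -> map_loz (fun tr => rot (rot (refl tr))) l' \in T.
  by move=> /fr /tiling_rot.
have key tr : R tr -> covers l tr -> on_axis tr -> axis_loz l.
  move=> Rtr cov /or3P [] /eqP h.
  - have := fixed _ tr frr Rtr cov; rewrite /= !rot2_refl => -[|e1 e2].
      by case: tr h {Rtr cov} => [[i j] u] /= ->.
    apply/or3P; constructor 1.
    by move: (congr1 (fun tr => tr.1.1) e1) (congr1 (fun tr => tr.1.1) e2) => /= -> ->; rewrite !eqxx.
  - have := fixed _ tr fr Rtr cov; rewrite /= !rot_refl => -[|e1 e2].
      by case: tr h {Rtr cov} => [[i j] u] /= <-.
    apply/or3P; constructor 2.
    by move: (congr1 (fun tr => tr.1.2) e1) (congr1 (fun tr => tr.1.2) e2) => /= -> ->; rewrite !eqxx.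
  - have := fixed _ tr tiling_refl Rtr cov; rewrite !reflE => -[|e1 e2].
      by case: tr h {Rtr cov} => [[i j] u] /= <-.
    apply/or3P; constructor 3.
    by move: (congr1 (fun tr => tr.1.1) e1) (congr1 (fun tr => tr.1.1) e2) => /= -> ->; rewrite !eqxx.
by case/orP; apply: key; rewrite ?tiling_R1 ?tiling_R2 // /covers eqxx ?orbT.
Qed.

(** One of the six symmetries carries [up_tri u] to [l.1]. Off the axes, its partner is determined
    by the sorted coordinates, so the image of the whole lozenge is [l]. *)
Lemma tiling_orbit l u d : (up_tri u, down_tri d) \in T -> wedge_up u -> wedge_down d ->
  is_lozenge l -> sorted_coords l.1 u -> sorted_coords l.2 d -> l \in T.
Proof.
move=> cT wu wd hl hu hd.
have sub (f : tri -> tri) : (forall tr p, sorted_coords (f tr) p = sorted_coords tr p) ->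
    map_loz f (up_tri u, down_tri d) \in T -> f (up_tri u) = l.1 -> l \in T.
  move=> sf fT e; suff <- : map_loz f (up_tri u, down_tri d) = l by [].
  have hf : is_lozenge (l.1, f (down_tri d)) by rewrite -e; exact: tiling_loz fT.
  rewrite [RHS]surjective_pairing /map_loz e; congr pair.
  apply: (adjacent_down_uniq hf) hd; rewrite -?surjective_pairing //.
    exact: sorted_coords_off_axis hu.
  by rewrite sf; exact: sorted_down_tri.
have [uT _] : l.1.2 /\ True by case: (l) hl => ? ? /is_lozengeP [].
have e1 : third (up_tri u) = u.2 := third_up_tri u.
have tE : third l.1 = L%:Z - 1 - l.1.1.1 - l.1.1.2 by rewrite /third /tri_sum uT.
have rc tr p : sorted_coords (rot (rot tr)) p = sorted_coords tr p by rewrite !sorted_coords_rot.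
have c1 tr p : sorted_coords (rot (refl tr)) p = sorted_coords tr p.
  by rewrite sorted_coords_rot sorted_coords_refl.
have c2 tr p : sorted_coords (rot (rot (refl tr))) p = sorted_coords tr p.
  by rewrite !sorted_coords_rot sorted_coords_refl.
have lE i j : l.1.1.1 = i -> l.1.1.2 = j -> l.1 = (i, j, true).
  by move: uT; case: (l.1) => [[? ?] ?] /= -> -> ->.
case: (sorted_coords_cases hu) => [[h1 h2]|[h1 h2]|[[h1 h2]|[h1 h2]|[h1 h2]|[h1 h2]]].
- apply: (sub (fun tr => rot (rot tr))) => //; first exact: (tiling_rot (tiling_rot cT)).
  by rewrite (lE _ _ h1 h2) rotE third_rot rotE e1.
- apply: (sub refl); [exact: sorted_coords_refl|exact: tiling_refl|].
  by rewrite (lE _ _ h1 h2) reflE e1.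
- apply: (sub (fun tr => rot (rot (refl tr)))) => //.
    exact: (tiling_rot (tiling_rot (tiling_refl cT))).
  by rewrite rot2_refl (lE _ (L%:Z - 1 - u.1%:Z - u.2%:Z) h1) //; move: tE; rewrite h1 h2; lia.
- apply: (sub rot); [exact: sorted_coords_rot|exact: tiling_rot|].
  by rewrite rotE e1 (lE _ (L%:Z - 1 - u.1%:Z - u.2%:Z) h1) //; move: tE; rewrite h1 h2; lia.
- apply: (sub id); [by []|exact: cT|].
  by rewrite (lE (L%:Z - 1 - u.1%:Z - u.2%:Z) _ _ h1) //; move: tE; rewrite h1 h2; lia.
- apply: (sub (fun tr => rot (refl tr))) => //; first exact: (tiling_rot (tiling_refl cT)).
  by rewrite rot_refl e1 (lE (L%:Z - 1 - u.1%:Z - u.2%:Z) _ _ h1) //; move: tE; rewrite h1 h2; lia.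
Qed.

(** Adjacent triangles differ by one in a single coordinate, so the order of the coordinates cannot
    change without two of them becoming equal. *)
Lemma wedge_neighbour (d : nat * nat) u' : wedge_down d -> is_lozenge (u', down_tri d) ->
  ~~ on_axis u' -> exists p, [/\ p \in neighbours d, u' = up_tri p & sorted_coords u' p].
Proof.
case: u' d => [[i j] u] [b c] /and3P [h1 h2 _] /is_lozengeP [/= uT [_ h]].
rewrite /= in h1 h2.
rewrite uT /on_axis /third /tri_sum /= => na.
have {h} [[e1 e2]|[[e1 e2]|[e1 e2]]] : (i = L%:Z - 2 - b%:Z - c%:Z /\ j = b) \/
  (i = L%:Z - 1 - b%:Z - c%:Z /\ j = b) \/ (i = L%:Z - 2 - b%:Z - c%:Z /\ j = b%:Z + 1).
  by case: h => [[<- <-]|[[h h']|[h h']]]; lia.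
- exists (b, c.+1); split; first by rewrite !inE /north /= eqxx !orbT.
    by rewrite /up_tri /=; congr (_, _, _); lia.
  by apply: sorted_coordsI; rewrite /third /tri_sum /=; [lia|lia|constructor 3; constructor 3; split; lia].
- exists (b, c); split; first by rewrite !inE eqxx.
    by rewrite /up_tri /=; congr (_, _, _); lia.
  by apply: sorted_coordsI; rewrite /third /tri_sum /=; [lia|lia|constructor 3; constructor 3; split; lia].
- exists (b.+1, c); split; first by rewrite !inE /east /= eqxx !orbT.
    by rewrite /up_tri /=; congr (_, _, _); lia.
  by apply: sorted_coordsI; rewrite /third /tri_sum /=; [lia|lia|constructor 3; constructor 3; split; lia].
Qed.

Lemma wedge_neighbour_up (u : nat * nat) d' : wedge_up u -> is_lozenge (up_tri u, d') ->
  ~~ on_axis d' -> R d' -> exists p, [/\ u \in neighbours p, d' = down_tri p & sorted_coords d' p].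
Proof.
case: d' u => [[i j] d] [b c] /and3P [h1 h2 _] /is_lozengeP [_ [/= dF h]].
rewrite /= in h1 h2.
rewrite dF /on_axis in_H2E /third /tri_sum /= => na /and4P [_ /andP [j0 _] _ _].
case: h => [[e1 e2]|[[e1 e2]|[e1 e2]]].
- exists (b, c.-1); split; first by rewrite !inE /north /= !xpair_eqE !eqxx /= prednK ?eqxx ?orbT //; lia.
    by rewrite /down_tri /=; congr (_, _, _); lia.
  by apply: sorted_coordsI; rewrite /third /tri_sum /=; [lia|lia|constructor 3; constructor 3; split; lia].
- exists (b, c); split; first by rewrite !inE eqxx.
    by rewrite /down_tri /=; congr (_, _, _); lia.
  by apply: sorted_coordsI; rewrite /third /tri_sum /=; [lia|lia|constructor 3; constructor 3; split; lia].
- exists (b.-1, c); split; first by rewrite !inE /east /= !xpair_eqE !eqxx /= prednK ?eqxx ?orbT //; lia.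
    by rewrite /down_tri /=; congr (_, _, _); lia.
  by apply: sorted_coordsI; rewrite /third /tri_sum /=; [lia|lia|constructor 3; constructor 3; split; lia].
Qed.

Lemma down_tri_inj : injective down_tri.
Proof. by case=> b c [b' c'] [h1 h2]; congr pair; lia. Qed.

Lemma up_tri_inj : injective up_tri.
Proof. by case=> b c [b' c'] [h1 h2]; congr pair; lia. Qed.

Lemma tiling_tile : exists2 m, m \in matchings downs ups & T = tile m.
Proof.
pose P d u := [/\ u \in neighbours d, (up_tri u, down_tri d) \in T & wedge_up u].
have [d | m [m1 m2]] := @graph_seq _ _ downs P.
  rewrite mem_downs => wd; have sd := sorted_down_tri wd.
  have Rd : R (down_tri d) by rewrite (R_down sd).
  have [[u' d'] lT cov] := tiling_ex Rd.
  have /= E := @covers_down _ (down_tri d) (tiling_loz lT) isT cov; subst d'.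
  have na : ~~ on_axis u'.
    apply/negP => ax; have := tiling_axis lT; rewrite /= ax => /(_ isT) /axis_loz_on_axis [_ /=].
    exact/negP/sorted_coords_off_axis/sd.
  have [p [p1 p2 p3]] := wedge_neighbour wd (tiling_loz lT) na.
  exists p; rewrite /P -p2; split=> //.
  by rewrite -(R_up p3) ?(tiling_R1 lT) // p2.
have uT e : e \in m -> (up_tri e.2, down_tri e.1) \in T by move=> /m2 [].
have wu e : e \in m -> wedge_up e.2 by move=> /m2 [].
have wd e : e \in m -> wedge_down e.1.
  by move=> em; rewrite -mem_downs -m1; apply: map_f.
have hm : m \in matchings downs ups.
  rewrite mem_matchings ?ups_uniq // m1 eqxx /=; apply/andP; split; last first.
    by apply/allP => e /m2 [].
  apply: uniq_perm; last 1 first.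
  - move=> u; rewrite mem_ups; apply/mapP/idP => [[e em ->]|wup]; first exact: wu.
    have su := sorted_up_tri wup; have Ru : R (up_tri u) by rewrite (R_up su).
    have [[u' d'] lT cov] := tiling_ex Ru.
    have /= E := @covers_up _ (up_tri u) (tiling_loz lT) isT cov; subst u'.
    have na : ~~ on_axis d'.
      apply/negP => ax; have := tiling_axis lT; rewrite /= ax orbT => /(_ isT) /axis_loz_on_axis [/=].
      by move=> h _; move/negP: (sorted_coords_off_axis su).
    have [p [p1 p2 p3]] := wedge_neighbour_up wup (tiling_loz lT) na (tiling_R2 lT).
    have : p \in downs by rewrite mem_downs -(R_down p3) ?(tiling_R2 lT) // p2.
    rewrite -m1 => /mapP [e em pe]; exists e => //.
    have Rd : R (down_tri p) by rewrite -p2; exact: (tiling_R2 lT).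
    have := tiling_uniq Rd lT (uT _ em); rewrite /covers /= p2 pe !eqxx !orbT => /(_ isT isT) E.
    exact: up_tri_inj (congr1 fst E).
  - rewrite map_inj_in_uniq; first by apply: (@map_uniq _ _ fst); rewrite -/(unzip1 m) m1 downs_uniq.
    have u1 : uniq (unzip1 m) by rewrite m1; exact: downs_uniq.
    move=> e e' em em' E; apply: (uniq_map_inj u1) => //.
    have Ru : R (up_tri e.2) by exact: tiling_R1 (uT _ em).
    have := tiling_uniq Ru (uT _ em) (uT _ em'); rewrite /covers /= E !eqxx => /(_ isT isT).
    by move=> H; exact: down_tri_inj (congr1 snd H).
  - exact: ups_uniq.
exists m => //.
have sub l : l \in tile m -> l \in T.
  case: l => u d lm; have [tl _] := tile_tiling hm.
  have /and3P [hl R1 R2] := tl _ lm.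
  case: (boolP (on_axis u)) => ax.
    have [[u' d'] lT cov] := tiling_ex R1.
    have [u2 _] := is_lozengeP hl.
    have /= E := covers_up (tiling_loz lT) u2 cov; subst u'.
    suff -> : d = d' by [].
    apply: (axis_down_uniq R1 hl (tiling_loz lT)).
      by apply: (tile_axis lm); rewrite /= ax.
    by apply: tiling_axis; rewrite //= ax.
  have [|e em /andP [h1 h2]] := tile_off_axis lm; first by rewrite /= ax.
  exact: tiling_orbit (uT _ em) (wu _ em) (wd _ em) hl h2 h1.
(* Inclusion is enough: the lozenge of [tile m] that covers [l.1] lies in [T], so it is [l]. *)
apply/fsetP => l; apply/idP/idP => [lT|]; last exact: sub.
have [_ tl] := tile_tiling hm; have [[l' l'm cov] _] := tl _ (tiling_R1 lT).
by rewrite (tiling_uniq (tiling_R1 lT) lT (sub _ l'm) _ cov) // /covers eqxx.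
Qed.

End Tiling.

Lemma CSTC_count : exists S : {fset {fset loz}},
  (forall T : {fset loz}, T \in S <-> is_CSTC_tiling t y a x T) /\
  #|` S|%fset = size (matchings downs ups).
Proof.
exists [fset T in [seq tile m | m <- matchings downs ups]]%fset; split.
  move=> T; rewrite !inE /=; split => [/mapP [m hm ->]|hT]; first exact: tile_CSTC.
  by have [m hm ->] := tiling_tile hT; apply: map_f.
rewrite card_fseq undup_id ?size_map // map_inj_in_uniq.
  by apply: matchings_uniq; exact: ups_uniq.
by move=> m m' hm hm'; apply: tile_inj.
Qed.

End Wedge.

(** * From path counts to the ballot determinant *)

Lemma binr_fac (a b : nat) : 'C(a + b, a)%:R = fac (a + b) / (fac a * fac b).
Proof.
have := bin_fact (leq_addr b a); rewrite addKn /fac => <-.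
by rewrite !natrM mulfK // mulf_neq0 ?fac_neq0.
Qed.

Lemma ballot_number (ex no : nat) : (ex <= no)%N ->
  'C(ex + no, ex)%:R - (if ex is ex'.+1 then 'C(ex + no, ex')%:R else 0) =
  (no.+1 - ex)%N%:R * fac (ex + no) / (fac ex * fac no.+1) :> rat.
Proof.
case: ex => [|k] h; rewrite binr_fac.
  by rewrite subr0 subn0 facS; field; rewrite !fac_neq0 nat1r pnatr_eq0.
rewrite addSnnS binr_fac natrB ?ltnS 1?ltnW // !facS.
by field; rewrite !fac_neq0 !nat1r !pnatr_eq0.
Qed.

(** The point [e] runs through the line [e.1 + 2 * e.2 = 3 * w + 2 * X + 1], parametrised by [s].
    Reflecting the start [(c, c.+1)] yields the subtracted binomial. *)
Lemma signed_paths_wall_ballot_entry (e : nat * nat) (c w s X : nat) :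
  (e.1 < e.2)%N -> (e.1 + 2 * s = w.+1)%N -> (e.2 = w + X + s)%N -> (c <= w)%N ->
  signed_paths e (c, c.+1) = ballot_entry X s (w - c).
Proof.
case: e => j k /= hjk h1 h2 hc; rewrite /signed_paths /lattice_paths /ballot_entry /=.
case: (leqP c j) => hcj; last first.
  by rewrite ifF ?subrr; last lia; rewrite ifF //; lia.
rewrite (_ : (c < k)%N) /=; last by lia.
have -> : (2 * s <= (w - c).+1)%N by lia.
have e1 : (k - c = (k - c.+1).+1)%N by lia.
have -> : (X + 3 * s - 1 = (k - c.+1).+1 - (j - c))%N by lia.
have -> : (2 * (w - c) + X - s = (j - c) + (k - c.+1))%N by lia.
have -> : ((w - c).+1 - 2 * s = j - c)%N by lia.
have -> : (w - c + X + s = (k - c.+1).+1)%N by lia.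
rewrite -ballot_number; last by lia.
congr (_ - _); case: ltnP => hcj'.
  have -> : (j - c = (j - c.+1).+1)%N by lia.
  by rewrite ifT; [congr ('C(_, _)%:R); lia | lia].
by have -> : (j - c = 0)%N by lia.
Qed.

(** [N i] counts the paths off the diagonal from [(j, k)] to the [i]-th point of the starting line,
    which every path to [e] crosses once. Only the path going straight north reaches the point with
    [i = j]. *)
Lemma signed_paths_expand (t : nat) s (j k : nat) : (j < k)%N -> (j + k + s).+1 = (2 * t)%N ->
  exists N : nat -> rat,
    [/\ forall e : nat * nat, (e.1 < e.2)%N -> (2 * t <= level e)%N ->
          signed_paths e (j, k) = \sum_(i < t) N i * signed_paths e (i : nat, (2 * t - i).-1),
        forall i, (i < j)%N -> N i = 0 & N j = 1].
Proof.
elim: s j k => [|s IH] j k hjk hs.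
  exists (fun i => (i == j)%:R); split.
  - move=> e _ _; have jt : (j < t)%N by lia.
    rewrite (bigD1 (Ordinal jt)) //= eqxx mul1r big1 ?addr0.
      by congr (signed_paths _ (_, _)); lia.
    by move=> i; rewrite -val_eqE => /= /negbTE ->; rewrite mul0r.
  - by move=> i hi; rewrite ltn_eqF.
  - by rewrite eqxx.
have rec e : (e.1 < e.2)%N -> (2 * t <= level e)%N ->
    signed_paths e (j, k) = signed_paths e (j.+1, k) + signed_paths e (j, k.+1).
  move=> he hl; apply: signed_paths_rec => //.
  by apply: contraTneq hl => <-; rewrite /level /= -ltnNge; lia.
have [|N2 [h2 z2 o2]] := IH j k.+1 (ltnW hjk); first by lia.
move: hjk; rewrite leq_eqVlt => /orP [/eqP jk|hjk].
  by exists N2; split=> // e he hl; rewrite rec // jk signed_paths_diag add0r -h2 // -jk.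
have [|N1 [h1 z1 o1]] := IH j.+1 k hjk; first by lia.
exists (fun i => N1 i + N2 i); split.
- move=> e he hl; rewrite rec // h1 // h2 // -big_split /=.
  by apply: eq_bigr => i _; rewrite mulrDl.
- by move=> i hi; rewrite z1 ?z2 ?addr0 // ltnW.
- by rewrite z1 // o2 add0r.
Qed.

(* The change of basis from the points of the starting line to points on the diagonal is unitriangular. *)
Lemma det_start_wall (t : nat) (e : 'I_t -> nat * nat) :
  (forall r, ((e r).1 < (e r).2)%N) -> (forall r, (2 * t <= level (e r))%N) ->
  \det (\matrix_(r, c) signed_paths (e c) (r : nat, (2 * t - r).-1)) =
  \det (\matrix_(r, c) signed_paths (e c) (r : nat, r.+1)).
Proof.
move=> h1 h2.
have ex (r : 'I_t) : exists N : nat -> rat,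
    [/\ forall e : nat * nat, (e.1 < e.2)%N -> (2 * t <= level e)%N ->
          signed_paths e (r : nat, r.+1) =
          \sum_(i < t) N i * signed_paths e (i : nat, (2 * t - i).-1),
        forall i, (i < r)%N -> N i = 0 & N r = 1].
  have hr := ltn_ord r.
  by apply: (@signed_paths_expand _ (2 * (t - r.+1))) => //; lia.
have [N hN] := fin_all_exists ex.
pose U : 'M[rat]_t := \matrix_(r, i) N r i.
have dU : \det U = 1.
  rewrite -det_tr det_trig.
    by rewrite big1 // => i _; rewrite !mxE; case: (hN i).
  by apply/is_trig_mxP => i j ij; rewrite !mxE; have [_ z _] := hN j; exact: z.
rewrite -[LHS]mul1r -dU -det_mulmx; congr determinant; apply/matrixP => r c; rewrite !mxE.
case: (hN r) => -> // _ _; by apply: eq_bigr => i _; rewrite !mxE.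
Qed.

Lemma det_perm2 (t : nat) (A : nat -> nat -> rat) (f g : 'I_t -> 'I_t) :
  injective f -> injective g ->
  `|\det (\matrix_(r < t, c < t) A (f r) (g c))| = `|detn t A|.
Proof.
move=> fi gi; pose M : 'M[rat]_t := \matrix_(r < t, c < t) A r c.
have -> : \matrix_(r < t, c < t) A (f r) (g c) = row_perm (perm fi) (col_perm (perm gi) M).
  by apply/matrixP => r c; rewrite !mxE !permE.
rewrite row_permE col_permE !det_mulmx !det_perm !normrM !normr_sign mul1r mulr1.
by [].
Qed.

Lemma gap_product_gt0 X y w a : 0 < gap_product X y w a.
Proof.
have f m : 0 < fac m by rewrite ltr0n fact_gt0.
have d m : 0 < dfac m by rewrite divr_gt0.
have H s g m : (forall k, 0 < g k) -> 0 < stepprod s g m :> rat.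
  by move=> g0; apply: prodr_gt0.
by rewrite /gap_product /prefactor !(mulr_gt0, invr_gt0) ?exprn_gt0 ?H.
Qed.

Section Count.

Variables (y t a x : nat).
Hypothesis hyt : (y < t)%N.

(** The indices from [y] to [y + a - 1] are skipped: the corresponding points lie in the satellite
    hole. *)
Definition end_index (r : nat) : nat := if (r < y)%N then r else (r + a)%N.

Definition path_end (l : nat) : nat * nat :=
  (2 * t + 2 * a - 2 - 2 * end_index l, 2 * t + 2 * a + x + end_index l)%N.

(** The numbering is reversed so that first coordinates increase with [r], as [weakly_se]
    requires. *)
Let e (r : 'I_t) : nat * nat := path_end (t - r.+1).

Lemma size_matchings_det_start :
  (size (matchings (downs y t a x) (ups y t a x)))%:R =
  \det (\matrix_(r < t, c < t) signed_paths (e c) (r : nat, (2 * t - r).-1)).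
Proof.
have eE (r : 'I_t) : exists l, [/\ e r = (2 * t + 2 * a - 2 - 2 * l, 2 * t + 2 * a + x + l)%N,
    (l < t + a)%N & ((l < y) || (y + a <= l))%N].
  exists (end_index (t - r.+1)); split=> //; rewrite /end_index; have := ltn_ord r; case: ifP; lia.
have codom_start (p : nat * nat) : (p.1 < p.2)%N -> ((p.1 + p.2).+1 = 2 * t)%N ->
    p \in codom (fun r : 'I_t => (r : nat, (2 * t - r).-1)).
  case: p => b c /= h1 h2; apply/codomP.
  have bt : (b < t)%N by lia.
  by exists (Ordinal bt); congr pair => /=; lia.
have start_lev (p : nat * nat) : p \in codom (fun r : 'I_t => (r : nat, (2 * t - r).-1)) ->
    (p.1 < p.2)%N /\ ((p.1 + p.2).+1 = 2 * t)%N.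
  by case/codomP => r ->; have := ltn_ord r => /=; lia.
have start_down (p : nat * nat) : (p.1 < p.2)%N -> ((p.1 + p.2).+1 = 2 * t)%N ->
    wedge_down y t a x p.
  by case: p => b c /= h1 h2; rewrite /wedge_down /hole_free /=; lia.
apply: (@size_matchings_det (wedge_up y t a x) (wedge_down y t a x)).
- move=> r r'; rewrite /e /path_end /end_index => -[h1 h2]; apply: val_inj => /=.
  have := ltn_ord r; have := ltn_ord r'; move: h1 h2; clear -hyt.
  by case: ifP; case: ifP; lia.
- move=> r r' lt; rewrite /weakly_se /e /path_end /end_index /=.
  have := ltn_ord r'; move: lt; clear -hyt.
  by case: ifP; case: ifP; lia.
- move=> p; apply/codomP/idP => [[r ->]|].
    have [l [-> l1 l2]] := eE r; rewrite /wedge_up /wedge_down /hole_free /=.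
    by move: l1 l2; clear -hyt; lia.
  case: p => b c; rewrite /wedge_up /wedge_down /hole_free /= => h.
  pose l := (c - (2 * t + 2 * a + x))%N.
  have lE : l = (c - (2 * t + 2 * a + x))%N by [].
  clearbody l; have [i [it il]] : exists i, (i < t)%N /\ end_index i = l.
    have [ly|ly] := ltnP l y.
      by exists l; rewrite /end_index ly; split=> //; exact: ltn_trans hyt.
    by exists (l - a)%N; move: h lE ly; rewrite /end_index; clear -hyt; case: ifP; lia.
  have rt : (t - i.+1 < t)%N by move: it; clear; lia.
  exists (Ordinal rt); rewrite /e /path_end /=.
  have -> : (t - (t - i.+1).+1 = i)%N by move: it; clear; lia.
  by rewrite il; move: h lE; clear -hyt => h lE; congr pair; lia.
- by move=> p /andP [].
- by move=> r; have [l [-> l1 l2]] := eE r; move: l1 l2; clear -hyt; rewrite /=; lia.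
- move=> r [b c] /and3P [_ h _]; rewrite [_.1]/= [_.2]/= in h; have [l [-> l1 l2]] := eE r; move: h l1 l2; clear -hyt.
  by rewrite /=; lia.
- move=> r r'; have [l [-> l1 l2]] := eE r; have [l' [-> l1' l2']] := eE r'.
  by move: l1 l1'; clear -hyt; rewrite /=; lia.
(* A step off the region leads to the diagonal or into a hole. All end points have first coordinate
   below [2 * t + 2 * a], and those with second coordinate at least [2 * t + 2 * a + x + y] have
   first coordinate below [2 * t - 2 * y], so none is reachable from a hole. *)
- move=> p p' r Dp hp' nU.
  have [dg|nd] := eqVneq p'.1 p'.2.
    by rewrite (surjective_pairing p') dg signed_paths_diag.
  have le : (p'.1 < p'.2)%N.
    case/andP: Dp => h _; move: hp' nd h; clear.
    by rewrite !inE => /orP [] /eqP ->; rewrite /east /north /=; lia.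
  have [l [er l1 l2]] := eE r.
  apply: signed_paths_eq0; first exact: ltnW.
    by rewrite er /=; move: l1 l2; clear -hyt; lia.
  apply: contra nU; rewrite er /= => h.
  have lv : (2 * t <= p'.1 + p'.2)%N.
    case/and4P: Dp => _ _ h' _; move: hp' h'; clear.
    by rewrite !inE => /orP [] /eqP ->; rewrite /east /north /=; lia.
  move: h lv le l1 l2; clear -hyt; rewrite /wedge_up /hole_free; case: p' => b c /=; lia.
- exact: downs_uniq.
- by apply: sort_sorted => p p'; exact: leq_total.
- by apply/allP => p; rewrite mem_downs.
- by move=> d p _ wd _; rewrite mem_downs.
- exact: ups_uniq.
- move=> p; have -> : (p \in ups y t a x) = wedge_up y t a x p by exact: mem_ups.
  have -> : (p \in downs y t a x) = wedge_down y t a x p by exact: mem_downs.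
  rewrite orbN /=; case: (boolP (wedge_up y t a x p)) => //= /and4P [_ _ h _].
  by symmetry; apply/negP => /start_lev [_ h']; rewrite -h' ltnn in h.
- by move=> r r' [] /val_inj.
- move=> r; have h := ltn_ord r; apply/orP; left; rewrite (mem_downs _ _ hyt).
  by apply: start_down => /=; lia.
- by move=> r r' lt; rewrite /weakly_se /=; have := ltn_ord r'; lia.
move=> p; have -> : (p \in downs y t a x) = wedge_down y t a x p by exact: mem_downs.
move=> /and4P [h1 h2 h3 h4] nU; apply: codom_start => //.
move: nU; rewrite /wedge_up h1 h4 andbT /=; move: h2 h3; clear; case: p => b c /=; lia.
Qed.

Lemma size_matchings_gap_product :
  (size (matchings (downs y t a x) (ups y t a x)))%:R = gap_product x y (t - y) a.
Proof.
have e_lt r : ((e r).1 < (e r).2)%N by rewrite /e /path_end /=; lia.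
have e_lev r : (2 * t <= level (e r))%N.
  rewrite /e /path_end /level /end_index /=; have := ltn_ord r; case: ifP; lia.
have E := size_matchings_det_start; rewrite det_start_wall // in E.
pose n := (t - y)%N; have nt : (y + n = t)%N by rewrite /n; lia.
have gP := gapdet_gap_product x y n a; rewrite nt in gP.
(* Both sides are nonnegative, so absolute values suffice and the signs of the row and column
   permutations need not be computed. *)
rewrite -[LHS]ger0_norm ?ler0n // E -[RHS]gtr0_norm ?gap_product_gt0 //.
have <- : `|gapdet x (t + 2 * a) y n a| = `|gap_product x y n a|.
  by rewrite gP normrM normr_sign mul1r.
rewrite /gapdet nt.
(* [f c] is the row of [gapdet] that belongs to the end point [e c]: the [n] indices beyond the gap
   come first there. *)
pose f (c : 'I_t) : nat := let l := (t - c.+1)%N in if (l < y)%N then (l + n)%N else (l - y)%N.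
have fP (c : 'I_t) : (f c < t)%N.
  rewrite /f; have := ltn_ord c; case: ifP; lia.
have fi : injective (fun c => Ordinal (fP c)).
  move=> c c' [] h; apply: val_inj => /=; have := ltn_ord c; have := ltn_ord c'; move: h.
  by rewrite /f; clear -nt; case: ifP; case: ifP; lia.
rewrite -(@det_perm2 t _ _ _ fi (@rev_ord_inj t)) -det_tr; congr (`|\det _|).
apply/matrixP => c r; rewrite !mxE /=.
have hr := ltn_ord r; have hc := ltn_ord c.
rewrite (@signed_paths_wall_ballot_entry _ r (2 * t + 2 * a - 1) (end_index (t - c.+1)).+1 x).
- congr ballot_entry; last by lia.
  rewrite /f /gap_row /end_index; have : (t - c.+1 < y + n)%N by lia.
  move: (t - c.+1)%N => i; have [iy|iy] := ltnP i y => hi.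
    by rewrite ifF; lia.
  by rewrite ifT; lia.
- exact: e_lt.
- rewrite /e /path_end /=; have : (t - c.+1 < t)%N by lia.
  by rewrite /end_index; move: (t - c.+1)%N => i; case: ifP; lia.
- rewrite /e /path_end /=; lia.
- lia.
Qed.

End Count.


Unset Implicit Arguments.
Local Open Scope fset_scope.

(* The set of CSTC tilings of H_{2t,y}(2a,2x) is finite, of cardinality P_1(x+1,y,t-y-1,a). *)
Theorem theorem2p3 (y t a x : nat) (hyt : (y < t)%N) :
  exists S : {fset {fset loz}},
    (forall T : {fset loz}, T \in S <-> is_CSTC_tiling t y a x T) /\
    (#|` S|%:R : rat) = P1 (x + 1)%:Z y%:Z (t%:Z - y%:Z - 1)%R a%:Z.
Proof.
have [S [hS cS]] := CSTC_count a x hyt; exists S; split=> //.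
rewrite cS size_matchings_gap_product //.
have [w wt] : exists w, (t - y = w.+1)%N by exists (t - y).-1; lia.
by rewrite wt (_ : t%:Z - y%:Z - 1 = w%:Z) ?P1_gap_product //; lia.
Qed.
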